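(* Let $a\in\mathbb{R}$, $z,w\in\mathbb{C}$ and $|\rho|<1$. Then $$\lim_{N\to\infty}S_{\rho,a,N}(z,w)=\sum_{m=0}^{\infty}\frac{\rho^m}{2^mm!}I_{a,m}(z,w)=\frac{1}{1-\rho}\,e^{-\frac{a^2}{4}+\frac{za}{\sqrt2}}\,e^{\left(z-\frac{a}{\sqrt2}\right)\overline{w}}\,e^{-\frac{\rho}{1-\rho}\left|z-\frac{a}{\sqrt2}-w\right|^2}.$$
   Context: The Hermite polynomials $H_m$ are defined by $e^{2xz-z^2}=\sum_{m\ge0}\frac{H_m(x)}{m!}z^m$, and the Segal–Bargmann kernel is $A_z(x)=\pi^{-1/4}e^{-\frac12(x^2+z^2)+\sqrt2zx}$, $z\in\mathbb{C}$, $x\in\mathbb{R}$. For $m\in\mathbb{N}_0$, $a\in\mathbb{R}$, $z,w\in\mathbb{C}$, $$I_{a,m}(z,w):=\int_{\mathbb{R}}H_m\left(\frac{z+\overline{z}}{\sqrt2}-x\right)H_m\left(\frac{w+\overline{w}}{\sqrt2}-x+a\right)A_z(x)\,\overline{A_w(x-a)}\,dx,$$ and $S_{\rho,a,N}(z,w)=\sum_{m=0}^{N}\frac{\rho^m}{2^mm!}I_{a,m}(z,w)$. *)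

(* Defs.v *)
From Stdlib Require Import Reals Factorial Lra Lia.
From Coquelicot Require Export Coquelicot.

Open Scope R_scope.

Local Ltac real_ring := match goal with |- ?u = ?v => change (@eq R u v); ring end.

Lemma pseries_everywhere_radius (a : nat -> R) (f : R -> R) :
  (forall z : R, is_pseries a z (f z)) ->
  forall z : R, Rbar_lt (Rabs z) (CV_radius a).
Proof.
intros H z.
destruct (Rbar_lt_le_dec (Rabs z) (CV_radius a)) as [h|h]; [exact h|exfalso].
assert (hz : Rbar_lt (CV_radius a) (Rabs (Rabs z + 1))).
{ apply Rbar_le_lt_trans with (1 := h); simpl.
  pose proof (Rabs_pos z); rewrite (Rabs_pos_eq (Rabs z + 1)); lra. }
apply (CV_disk_outside a (Rabs z + 1) hz), ex_series_lim_0.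
exists (f (Rabs z + 1)); apply is_pseries_R, H.
Qed.

Lemma is_pseries_exp_2xz (x z : R) :
  is_pseries (fun n => (2 * x) ^ n / INR (fact n)) z (exp (2 * x * z)).
Proof.
apply is_pseries_R.
apply is_series_ext with (2 := proj1 (is_pseries_R _ _ _) (is_exp_Reals (2 * x * z))).
intros n; rewrite (Rpow_mult_distr (2 * x)); unfold Rdiv; real_ring.
Qed.

Lemma is_pseries_exp_opp_sq (z : R) :
  is_pseries (fun n => if Nat.even n then (-1) ^ Nat.div2 n / INR (fact (Nat.div2 n)) else 0)
    z (exp (- z ^ 2)).
Proof.
replace (exp (- z ^ 2)) with (exp (- z ^ 2) + z * 0) by ring.
apply is_pseries_odd_even.
- apply is_pseries_R.
  apply is_series_ext with (2 := proj1 (is_pseries_R _ _ _) (is_exp_Reals (- z ^ 2))).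
  intros n; rewrite Nat.div2_double, Nat.even_mul; simpl Nat.even; cbn [orb].
  replace (- z ^ 2) with (-1 * z ^ 2) by ring.
  rewrite Rpow_mult_distr; unfold Rdiv; real_ring.
- apply is_pseries_R.
  apply is_series_ext with (a := fun _ : nat => 0).
  { intros n; rewrite Nat.even_add, Nat.even_mul; simpl Nat.even; cbn; real_ring. }
  apply is_series_Reals; intros eps heps; exists 0%nat; intros n _.
  rewrite sum_eq_R0 by reflexivity.
  rewrite R_dist_eq; exact heps.
Qed.

Definition hermite_generating (H : nat -> R -> R) : Prop :=
  forall x z : R,
    is_pseries (fun m => H m x / INR (fact m)) z (exp (2 * x * z - z ^ 2)).

Lemma hermite_family : { H : nat -> R -> R | hermite_generating H }.
Proof.
exists (fun m x => INR (fact m) *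
  PS_mult (fun n => (2 * x) ^ n / INR (fact n))
    (fun n => if Nat.even n then (-1) ^ Nat.div2 n / INR (fact (Nat.div2 n)) else 0) m).
intros x z.
unfold Rminus; rewrite exp_plus.
eapply is_pseries_ext; cycle 1.
- apply is_pseries_mult.
  + apply is_pseries_exp_2xz.
  + apply is_pseries_exp_opp_sq.
  + apply pseries_everywhere_radius with (1 := is_pseries_exp_2xz x).
  + apply pseries_everywhere_radius with (1 := is_pseries_exp_opp_sq).
- intros n; simpl; field; apply INR_fact_neq_0.
Qed.

(* The only property of [hermite] available is its generating identity, which
   determines it: see [hermite_unique]. *)
Definition hermite : nat -> R -> R := proj1_sig hermite_family.

Lemma hermiteP : hermite_generating hermite.
Proof. exact (proj2_sig hermite_family). Qed.

Lemma hermite_unique (H : nat -> R -> R) :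
  hermite_generating H -> forall m x, H m x = hermite m x.
Proof.
intros HH m x.
assert (rH := pseries_everywhere_radius _ _ (HH x)).
assert (rh := pseries_everywhere_radius _ _ (hermiteP x)).
assert (E : H m x / INR (fact m) = hermite m x / INR (fact m)).
{ apply (PSeries_ext_recip (fun n => H n x / INR (fact n))
           (fun n => hermite n x / INR (fact n))).
  - rewrite <- Rabs_R0; apply rH.
  - rewrite <- Rabs_R0; apply rh.
  - exists (mkposreal 1 Rlt_0_1); intros z _.
    now rewrite (is_pseries_unique _ _ _ (HH x z)),
      (is_pseries_unique _ _ _ (hermiteP x z)). }
apply (Rmult_eq_reg_r (/ INR (fact m))); [exact E|].
apply Rinv_neq_0_compat, INR_fact_neq_0.
Qed.

Definition Cexp (z : C) : C :=
  (exp (Re z) * cos (Im z), exp (Re z) * sin (Im z)).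

Definition SB_kernel (z : C) (x : R) : C :=
  (RtoC (Rpower PI (- / 4)) *
   Cexp (- / 2 * (RtoC x ^ 2 + z ^ 2) + RtoC (sqrt 2) * z * RtoC x))%C.

(* [hermite] takes real arguments; [Re] only retypes the real number z + conj z. *)
Definition I_integrand (a : R) (m : nat) (z w : C) (x : R) : C :=
  (RtoC (hermite m (Re (z + Cconj z) / sqrt 2 - x)%R) *
   RtoC (hermite m (Re (w + Cconj w) / sqrt 2 - x + a)%R) *
   SB_kernel z x * Cconj (SB_kernel w (x - a)%R))%C.

(* The integral over the line is the improper Riemann integral, with independent
   limits at both ends; C is viewed as a complete normed R-module. *)
Definition I_int (a : R) (m : nat) (z w : C) : C :=
  RInt_gen (V := C_R_CompleteNormedModule) (I_integrand a m z w)
    (Rbar_locally m_infty) (Rbar_locally p_infty).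

(* [sum_n u N] is the sum of u m for 0 <= m <= N, the last index included. *)
Definition S_sum (rho : C) (a : R) (N : nat) (z w : C) : C :=
  sum_n (fun m : nat => (rho ^ m / RtoC (2 ^ m * INR (fact m))%R * I_int a m z w)%C) N.

Definition closed_form (rho : C) (a : R) (z w : C) : C :=
  (1 / (1 - rho) *
   Cexp (RtoC (- (a ^ 2 / 4))%R + z * RtoC a / RtoC (sqrt 2)) *
   Cexp ((z - RtoC a / RtoC (sqrt 2)) * Cconj w) *
   Cexp (- (rho / (1 - rho)) *
         RtoC (Cmod (z - RtoC a / RtoC (sqrt 2) - w) ^ 2)%R))%C.

(* Main.v *)
Require Import Defs.
From Stdlib Require Import Reals Factorial Lra Lia.
From Coquelicot Require Import Coquelicot.
From mathcomp Require ssrnat binomial.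

(** Up to a constant, the integrand of I_{a,m} is the Gaussian exp(-x^2 + kappa x),
    kappa = sqrt 2 (z + conj w) + a, times H_m(p - x) H_m(q - x), where
    p = sqrt 2 Re z and q = sqrt 2 Re w + a.  Let M(m,n) be the integral of
    exp(-x^2 + kappa x) H_m(p - x) H_n(q - x).  The derivative of that product is a
    combination of products of the same kind, because H_k' = 2k H_{k-1} and
    H_{k+1}(y) = 2y H_k(y) - 2k H_{k-1}(y), and its integral vanishes, because the
    Gaussian kills the boundary terms.  This gives (with existence of each integral
    coming for free, by induction)

      M(m+1,n) = A M(m,n) + 2n M(m,n-1),      A = 2p - kappa,
      M(0,n+1) = B M(0,n),                    B = 2q - kappa,

    so that only the complex Gaussian integral M(0,0) = sqrt pi exp(kappa^2/4) is ever
    computed.  Solving the recursion on the diagonal,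

      M(m,m) = M(0,0) 2^m m! sum_j C(m,j) (AB/2)^j / j!,

    a Laguerre polynomial at -AB/2 = |z - a/sqrt 2 - w|^2 ([is_int_herm_gauss],
    [I_int_value]).

    It remains to sum the Laguerre polynomials ([laguerre_generating]): exchange the
    summations over m and j, use the negative binomial series
    sum_m C(m,j) rho^m = rho^j / (1-rho)^(j+1) ([nbin_lim]) and recognize an exponential
    series ([Cexp_series]).  The exchange is a dominated convergence argument
    ([tannery]), the partial sums of the inner series being bounded by
    |rho|^j / (1-|rho|)^(j+1). *)

(* Operations of the abstract algebraic structures over R and C often hide the carrier
   from [ring] and [field]; these restore it. *)
Local Ltac R_change := match goal with |- ?u = ?v => change (@eq R u v) end.
Local Ltac C_change := match goal with |- ?u = ?v => change (@eq C u v) end.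

(** * Differentiation of complex functions of a real variable *)

Local Notation is_derive_RC := (is_derive (V := C_R_NormedModule)).

Lemma is_derive_C_iff (f : R -> C) (x : R) (l : C) :
  is_derive_RC f x l <->
  is_derive (fun t => fst (f t)) x (fst l) /\ is_derive (fun t => snd (f t)) x (snd l).
Proof.
split.
- intros H; split.
  + exact (filterdiff_comp f (fun z : prod_NormedModule _ R_NormedModule R_NormedModule => fst z)
      _ _ H (filterdiff_linear _ is_linear_fst)).
  + exact (filterdiff_comp f (fun z : prod_NormedModule _ R_NormedModule R_NormedModule => snd z)
      _ _ H (filterdiff_linear _ is_linear_snd)).
- intros [H1 H2].
  apply (is_derive_scal_l (V := C_R_NormedModule) _ _ _ (1, 0)) in H1.
  apply (is_derive_scal_l (V := C_R_NormedModule) _ _ _ (0, 1)) in H2.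
  assert (E : forall r s : R,
    @plus C_R_NormedModule (scal r ((1, 0) : C)) (scal s ((0, 1) : C)) = (r, s)).
  { intros r s; apply injective_projections; cbn; unfold plus, scal; cbn; unfold mult; cbn; ring. }
  assert (H := is_derive_plus _ _ _ _ _ H1 H2).
  rewrite E, <- surjective_pairing in H.
  apply is_derive_ext with (2 := H); intros t; rewrite E, <- surjective_pairing; reflexivity.
Qed.

Lemma is_derive_RtoC (f : R -> R) (x l : R) :
  is_derive f x l -> is_derive_RC (fun t => RtoC (f t)) x (RtoC l).
Proof.
intros H; apply is_derive_C_iff; split; cbn; [exact H|apply (is_derive_const
  (V := R_NormedModule))].
Qed.

Lemma is_derive_Cplus (f g : R -> C) (x : R) (df dg : C) :
  is_derive_RC f x df -> is_derive_RC g x dg ->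
  is_derive_RC (fun t => f t + g t)%C x (df + dg)%C.
Proof. exact (is_derive_plus f g x df dg). Qed.

Lemma is_derive_Cmult (f g : R -> C) (x : R) (df dg : C) :
  is_derive_RC f x df -> is_derive_RC g x dg ->
  is_derive_RC (fun t => f t * g t)%C x (df * g x + f x * dg)%C.
Proof.
intros [F1 F2]%is_derive_C_iff [G1 G2]%is_derive_C_iff.
apply is_derive_C_iff; cbn.
set (f1 := fun t => fst (f t)) in *; set (f2 := fun t => snd (f t)) in *.
change (is_derive f1 x (fst df)) in F1; change (is_derive f2 x (snd df)) in F2.
set (g1 := fun t => fst (g t)) in *; set (g2 := fun t => snd (g t)) in *.
change (is_derive g1 x (fst dg)) in G1; change (is_derive g2 x (snd dg)) in G2.
split.
- change (is_derive (fun t => f1 t * g1 t - f2 t * g2 t) x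
    (fst df * g1 x - snd df * g2 x + (f1 x * fst dg - f2 x * snd dg))).
  auto_derive; [repeat split; eexists; eassumption|].
  change (fun t => f1 t) with f1; change (fun t => f2 t) with f2.
  change (fun t => g1 t) with g1; change (fun t => g2 t) with g2.
  rewrite (is_derive_unique _ _ _ F1), (is_derive_unique _ _ _ F2),
   (is_derive_unique _ _ _ G1), (is_derive_unique _ _ _ G2); ring.
- change (is_derive (fun t => f1 t * g2 t + f2 t * g1 t) x
    (fst df * g2 x + snd df * g1 x + (f1 x * snd dg + f2 x * fst dg))).
  auto_derive; [repeat split; eexists; eassumption|].
  change (fun t => f1 t) with f1; change (fun t => f2 t) with f2.
  change (fun t => g1 t) with g1; change (fun t => g2 t) with g2.
  rewrite (is_derive_unique _ _ _ F1), (is_derive_unique _ _ _ F2),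
   (is_derive_unique _ _ _ G1), (is_derive_unique _ _ _ G2); ring.
Qed.

Lemma is_derive_Cconst (c : C) (x : R) : is_derive_RC (fun _ => c) x (RtoC 0).
Proof. apply (is_derive_const (V := C_R_NormedModule)). Qed.

Lemma is_derive_Cexp (f : R -> C) (x : R) (df : C) :
  is_derive_RC f x df ->
  is_derive_RC (fun t => Cexp (f t)) x (df * Cexp (f x))%C.
Proof.
intros [F1 F2]%is_derive_C_iff.
apply is_derive_C_iff; cbn; unfold Re, Im.
set (f1 := fun t => fst (f t)) in *; set (f2 := fun t => snd (f t)) in *.
change (is_derive f1 x (fst df)) in F1; change (is_derive f2 x (snd df)) in F2.
split.
- change (is_derive (fun t => exp (f1 t) * cos (f2 t)) x
    (fst df * (exp (f1 x) * cos (f2 x)) - snd df * (exp (f1 x) * sin (f2 x)))).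
  auto_derive; [repeat split; eexists; eassumption|].
  change (fun t => f1 t) with f1; change (fun t => f2 t) with f2.
  rewrite (is_derive_unique _ _ _ F1), (is_derive_unique _ _ _ F2); ring.
- change (is_derive (fun t => exp (f1 t) * sin (f2 t)) x
    (fst df * (exp (f1 x) * sin (f2 x)) + snd df * (exp (f1 x) * cos (f2 x)))).
  auto_derive; [repeat split; eexists; eassumption|].
  change (fun t => f1 t) with f1; change (fun t => f2 t) with f2.
  rewrite (is_derive_unique _ _ _ F1), (is_derive_unique _ _ _ F2); ring.
Qed.

Lemma RtoC_INR_fact_neq_0 (n : nat) : RtoC (INR (fact n)) <> 0.
Proof. intros e; apply RtoC_inj in e; exact (INR_fact_neq_0 n e). Qed.

Lemma RtoC_INR_S_neq_0 (n : nat) : RtoC (INR (S n)) <> 0.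
Proof. intros e; apply RtoC_inj in e; exact (not_0_INR (S n) (Nat.neq_succ_0 n) e). Qed.

Lemma Cmod_pow_over_fact (y : C) (j : nat) : Cmod (y ^ j / INR (fact j)) =
  Cmod y ^ j / INR (fact j).
Proof.
rewrite Cmod_div by apply RtoC_INR_fact_neq_0.
rewrite Cmod_pow, Cmod_R, Rabs_pos_eq by apply pos_INR; reflexivity.
Qed.

Lemma Cexp_plus (u v : C) : Cexp (u + v) = (Cexp u * Cexp v)%C.
Proof.
apply injective_projections; cbn; unfold Re, Im; cbn;
rewrite exp_plus, ?cos_plus, ?sin_plus; ring.
Qed.

Lemma Cexp_0 : Cexp 0 = 1.
Proof. apply injective_projections; cbn; rewrite exp_0, ?cos_0, ?sin_0; ring. Qed.

Lemma Cexp_conj (u : C) : Cconj (Cexp u) = Cexp (Cconj u).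
Proof.
apply injective_projections; cbn; unfold Re, Im; cbn; rewrite ?cos_neg, ?sin_neg; ring.
Qed.

Lemma Cexp_RtoC (r : R) : Cexp r = exp r.
Proof. apply injective_projections; cbn; rewrite ?cos_0, ?sin_0; ring. Qed.

Lemma Cmod_Cexp (u : C) : Cmod (Cexp u) = exp (Re u).
Proof.
unfold Cmod; cbn [Cexp fst snd].
replace ((exp (Re u) * cos (Im u)) ^ 2 + (exp (Re u) * sin (Im u)) ^ 2)
  with (exp (Re u) ^ 2 * (Rsqr (sin (Im u)) + Rsqr (cos (Im u)))) by (unfold Rsqr; ring).
rewrite sin2_cos2, Rmult_1_r, sqrt_pow2; [reflexivity|].
apply Rlt_le, exp_pos.
Qed.

(** * Integrals of complex functions over the line *)

Local Notation is_int f l :=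
  (is_RInt_gen (V := C_R_NormedModule) f (Rbar_locally m_infty) (Rbar_locally p_infty) l).

(** Fundamental theorem of calculus on the line.  The existence of the integral is part
    of the conclusion: this is how integrability propagates along the recursion. *)
Lemma is_int_derive (F dF : R -> C) (la lb : C) :
  (forall x, is_derive_RC F x (dF x)) ->
  (forall x, continuous (U := C_R_NormedModule) dF x) ->
  filterlim F (Rbar_locally m_infty) (locally (T := C_R_NormedModule) la) ->
  filterlim F (Rbar_locally p_infty) (locally (T := C_R_NormedModule) lb) ->
  is_int dF (lb - la)%C.
Proof.
intros HF HdF Ha Hb.
apply (filterlimi_lim_ext (U := C_R_NormedModule) (fun ab => minus (F (snd ab)) (F
  (fst ab)) : C_R_NormedModule)).
- intros ab; apply (is_RInt_derive (V := C_R_CompleteNormedModule)); intros x _; auto.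
- unfold minus.
  apply filterlim_comp_2 with (3 := filterlim_plus (V := C_R_NormedModule) lb (opp la)).
  + eapply filterlim_comp; [apply filterlim_snd|exact Hb].
  + eapply filterlim_comp; [|exact (filterlim_opp (V := C_R_NormedModule) la)].
    eapply filterlim_comp; [apply filterlim_fst|exact Ha].
Qed.

Lemma is_int_comp_C (f : R -> C) (l : C) :
  is_int f l <->
  is_RInt_gen (fun t => fst (f t)) (Rbar_locally m_infty) (Rbar_locally p_infty) (fst l) /\
  is_RInt_gen (fun t => snd (f t)) (Rbar_locally m_infty) (Rbar_locally p_infty) (snd l).
Proof.
unfold is_RInt_gen; rewrite !filterlimi_locally.
split.
- intros H; split; intros eps; generalize (H eps); apply filter_imp; intros ab [z [Hz Bz]].
  + exists (fst z); split; [exact (is_RInt_fct_extend_fst _ _ _ _ Hz)|apply Bz].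
  + exists (snd z); split; [exact (is_RInt_fct_extend_snd _ _ _ _ Hz)|apply Bz].
- intros [H1 H2] eps; generalize (filter_and _ _ (H1 eps) (H2 eps)); apply filter_imp.
  intros ab [[z1 [Hz1 B1]] [z2 [Hz2 B2]]].
  exists (z1, z2); split; [exact (is_RInt_fct_extend_pair f _ _ z1 z2 Hz1 Hz2)|].
  split; [exact B1|exact B2].
Qed.

(** Here C is a module over R only: multiplication by a complex constant mixes the two
    components, each of which is a real linear combination. *)
Lemma is_int_Cmult (c : C) (f : R -> C) (l : C) :
  is_int f l -> is_int (fun x => c * f x)%C (c * l)%C.
Proof.
rewrite !is_int_comp_C; cbn; intros [H1 H2]; split.
- apply (is_RInt_gen_minus (V := R_NormedModule));
    apply (is_RInt_gen_scal (V := R_NormedModule)); assumption.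
- apply (is_RInt_gen_plus (V := R_NormedModule));
    apply (is_RInt_gen_scal (V := R_NormedModule)); assumption.
Qed.

Lemma is_int_Cplus (f g : R -> C) (lf lg : C) :
  is_int f lf -> is_int g lg -> is_int (fun x => f x + g x)%C (lf + lg)%C.
Proof. exact (is_RInt_gen_plus f g lf lg). Qed.

Lemma is_int_ext (f g : R -> C) (l : C) :
  (forall x, f x = g x) -> is_int f l -> is_int g l.
Proof.
intros E; apply is_RInt_gen_ext.
apply filter_forall; intros ab x _; apply E.
Qed.

(** * Gaussian decay *)

Lemma exp_le_exp (x y : R) : x <= y -> exp x <= exp y.
Proof.
intros [h| ->]; [apply Rlt_le, exp_increasing, h|apply Rle_refl].
Qed.

(** Since k|x| <= x^2/2 + k^2/2, the quantity is at most a constant times exp(-x^2/2),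
    hence at most a constant divided by 1 + x^2/2. *)
Lemma gaussian_small (K k eps : R) : 0 < eps ->
  exists X, forall x, X < Rabs x -> K * exp (- x ^ 2 + k * Rabs x) < eps.
Proof.
intros heps.
destruct (Rle_lt_dec K 0) as [hK|hK].
{ exists 0; intros x _; generalize (exp_pos (- x ^ 2 + k * Rabs x)); nra. }
(* For |x| > 1 one has 1 + x^2/2 > |x|/2, whence the second term of the maximum. *)
exists (Rmax 1 (2 * (K * exp (k ^ 2 / 2)) / eps)); intros x hx.
assert (h1 := Rle_lt_trans _ _ _ (Rmax_l _ _) hx).
assert (h2 := Rle_lt_trans _ _ _ (Rmax_r _ _) hx).
apply Rle_lt_trans with (K * (exp (k ^ 2 / 2) * exp (- (x ^ 2 / 2)))).
{ apply Rmult_le_compat_l; [lra|]; rewrite <- exp_plus; apply exp_le_exp.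
  rewrite <- (pow2_abs x); generalize (pow2_ge_0 (Rabs x - k)); nra. }
assert (h3 : exp (- (x ^ 2 / 2)) <= / (1 + x ^ 2 / 2)).
{ rewrite exp_Ropp; generalize (pow2_ge_0 x); intros; apply Rinv_le_contravar;
    [lra|apply exp_ineq1_le]. }
assert (hE := exp_pos (k ^ 2 / 2)).
set (E := exp (k ^ 2 / 2)) in *.
apply Rle_lt_trans with ((K * E) * / (1 + x ^ 2 / 2)).
{ rewrite <- Rmult_assoc; apply Rmult_le_compat_l; [nra|exact h3]. }
rewrite <- (pow2_abs x) in *; assert (h4 := pow2_ge_0 (Rabs x)).
apply (Rmult_lt_reg_r (1 + Rabs x ^ 2 / 2)); [nra|].
rewrite Rmult_assoc, Rinv_l, Rmult_1_r by nra.
apply (Rmult_lt_compat_r eps) in h2; [|exact heps].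
unfold Rdiv in h2; rewrite Rmult_assoc, Rinv_l, Rmult_1_r in h2 by lra.
assert (h5 : Rabs x * eps <= Rabs x ^ 2 * eps) by (apply Rmult_le_compat_r; nra).
lra.
Qed.

Lemma filterlim_gaussian_bound (F : R -> C) (K k : R) :
  (forall x, Cmod (F x) <= K * exp (- x ^ 2 + k * Rabs x)) ->
  filterlim F (Rbar_locally m_infty) (locally (T := C_R_NormedModule) (RtoC 0)) /\
  filterlim F (Rbar_locally p_infty) (locally (T := C_R_NormedModule) (RtoC 0)).
Proof.
intros HF.
assert (HB : forall eps : posreal, exists X, forall x, X < Rabs x ->
   ball (M := C_R_NormedModule) (RtoC 0) eps (F x)).
{ intros eps; destruct (gaussian_small K k eps (cond_pos eps)) as [X HX].
  exists X; intros x hx.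
  assert (h := Rle_lt_trans _ _ _ (HF x) (HX x hx)).
  assert (h' := Rmax_Cmod (F x)).
  split; cbn; unfold AbsRing_ball, abs, minus, plus, opp; cbn;
    rewrite Ropp_0, Rplus_0_r.
  - generalize (Rmax_l (Rabs (fst (F x))) (Rabs (snd (F x)))); lra.
  - generalize (Rmax_r (Rabs (fst (F x))) (Rabs (snd (F x)))); lra. }
split; apply filterlim_locally; intros eps; destruct (HB eps) as [X HX].
- exists (- Rabs X); intros x hx; apply HX.
  generalize (Rle_abs X) (Rle_abs (- x)); rewrite Rabs_Ropp; lra.
- exists (Rabs X); intros x hx; apply HX.
  generalize (Rle_abs X) (Rle_abs x); lra.
Qed.

(** * The Gaussian integral *)

Lemma continuous_exp_opp_sqr (x : R) : continuous (fun t => exp (- t ^ 2)) x.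
Proof. apply (ex_derive_continuous (V := R_NormedModule)); auto_derive; exact I. Qed.

Lemma ex_RInt_exp_opp_sqr (a b : R) : ex_RInt (fun t => exp (- t ^ 2)) a b.
Proof. apply (ex_RInt_continuous (V := R_CompleteNormedModule)); intros;
  apply continuous_exp_opp_sqr. Qed.

(** The left-hand side has derivative 0 in x: the second term has derivative
    -2 x int_0^1 exp(-x^2 (1+t^2)) dt, which is -2 exp(-x^2) int_0^x exp(-t^2) dt after
    the substitution x t.  At x = 0 it is int_0^1 1/(1+t^2) dt = atan 1. *)
Lemma gauss_half_square (x : R) :
  RInt (fun t => exp (- t ^ 2)) 0 x ^ 2 +
  RInt (fun t => exp (- (x ^ 2 * (1 + t ^ 2))) / (1 + t ^ 2)) 0 1 = PI / 4.
Proof.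
set (F := fun x => RInt (fun t => exp (- t ^ 2)) 0 x).
set (G := fun x => RInt (fun t => exp (- (x ^ 2 * (1 + t ^ 2))) / (1 + t ^ 2)) 0 1).
assert (HF : forall x, is_derive F x (exp (- x ^ 2))).
{ intros y; apply (is_derive_RInt (V := R_NormedModule) (fun t => exp (- t ^ 2)) F 0 y).
  - apply filter_forall; intros b; apply (RInt_correct (V := R_CompleteNormedModule)),
      ex_RInt_exp_opp_sqr.
  - apply continuous_exp_opp_sqr. }
assert (HG : forall x, is_derive G x (- 2 * exp (- x ^ 2) * F x)).
{ intros y.
  assert (D : forall u t, is_derive (fun z => exp (- (z ^ 2 * (1 + t ^ 2))) / (1 + t ^ 2)) u
     (- 2 * u * exp (- (u ^ 2 * (1 + t ^ 2))))).
  { intros u t; auto_derive; [nra|]. cbn [pow]; field; nra. }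
  replace (- 2 * exp (- y ^ 2) * F y) with
   (RInt (fun t => Derive (fun u => exp (- (u ^ 2 * (1 + t ^ 2))) / (1 + t ^ 2)) y) 0 1).
  - apply (is_derive_RInt_param (fun x t => exp (- (x ^ 2 * (1 + t ^ 2))) / (1 + t ^ 2))).
    + apply filter_forall; intros u t _; eexists; apply D.
    + intros t _.
      apply continuity_2d_pt_ext with (fun u v => - 2 * u * exp (- (u ^ 2 * (1 + v ^ 2)))).
      { intros u v; symmetry; apply is_derive_unique, D. }
      repeat first [apply continuity_2d_pt_mult | apply continuity_2d_pt_const
        | apply continuity_2d_pt_id1 | apply continuity_2d_pt_id2
        | apply continuity_2d_pt_plus | apply continuity_2d_pt_opp
        | apply (continuity_1d_2d_pt_comp exp); [apply derivable_continuous, derivable_exp|]].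
    + apply filter_forall; intros u; apply (ex_RInt_continuous (V := R_CompleteNormedModule));
        intros t _.
      apply (ex_derive_continuous (V := R_NormedModule)); auto_derive; nra.
  - rewrite (RInt_ext _ (fun t => (- 2 * exp (- y ^ 2)) * (y * exp (- (y * t + 0) ^ 2)))).
    + rewrite (RInt_scal (V := R_CompleteNormedModule) (fun t => y * exp (- (y * t + 0) ^ 2))).
      * assert (S : RInt (fun t : R => y * exp (- (y * t + 0) ^ 2)) 0 1 = F y).
        { unfold F.
          replace (RInt (fun t => exp (- t ^ 2)) 0 y)
            with (RInt (fun t => exp (- t ^ 2)) (y * 0 + 0) (y * 1 + 0)) by (f_equal; ring).
          apply (RInt_comp_lin (V := R_CompleteNormedModule) (fun t => exp (- t ^ 2)) y 0 0 1).
          apply ex_RInt_exp_opp_sqr. }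
        rewrite S; reflexivity.
      * apply (ex_RInt_continuous (V := R_CompleteNormedModule)); intros t _.
        apply (ex_derive_continuous (V := R_NormedModule)); auto_derive; exact I.
    + intros t _; etransitivity; [apply is_derive_unique, D|].
      replace (- (y ^ 2 * (1 + t ^ 2))) with (- y ^ 2 + - (y * t + 0) ^ 2) by ring.
      rewrite exp_plus; R_change; ring. }
change (F x ^ 2 + G x = PI / 4).
assert (E : F x ^ 2 + G x = F 0 ^ 2 + G 0).
{ destruct (MVT_gen (fun x => F x ^ 2 + G x) 0 x (fun _ => 0)) as [c [_ Hc]].
  - intros y _.
    evar_last.
    { apply (is_derive_plus (fun y => F y ^ 2) G); [|apply HG].
      apply (is_derive_pow F 2 y _ (HF y)). }
    cbn; unfold plus; cbn; ring.
  - intros y _; apply continuity_pt_filterlim, (ex_derive_continuous (V := R_NormedModule)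
      (fun y => F y ^ 2 + G y)).
    eexists; apply (is_derive_plus (fun y => F y ^ 2) G); [|apply HG].
    apply (is_derive_pow F 2 y _ (HF y)).
  - lra. }
rewrite E.
replace (F 0) with 0 by (symmetry; apply (RInt_point (V := R_CompleteNormedModule))).
replace (G 0) with (PI / 4); [ring|].
unfold G; symmetry; apply is_RInt_unique.
replace (PI / 4) with (minus (atan 1) (atan 0)) by (rewrite atan_1, atan_0;
  unfold minus, plus, opp; cbn; ring).
apply is_RInt_ext with (fun t => / (1 + t ^ 2)).
{ intros t _; replace (- (0 ^ 2 * (1 + t ^ 2))) with 0 by ring; rewrite exp_0; R_change; field;
    nra. }
apply (is_RInt_derive (V := R_CompleteNormedModule)).
- intros t _; auto_derive; [exact I|]; field; nra.
- intros t _; apply (ex_derive_continuous (V := R_NormedModule)); auto_derive; nra.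
Qed.

(** Write F for the integral, s for the limit and G = s^2 - F^2 for the second term of
    [gauss_half_square]; then 0 <= G <= exp(-x^2), and s - F <= 2 G since F + s >= 1/2. *)
Lemma gauss_half_line :
  is_lim (fun x => RInt (fun t => exp (- t ^ 2)) 0 x) p_infty (sqrt PI / 2).
Proof.
assert (hpi := PI_4). assert (hpi2 := PI2_1).
set (s := sqrt PI / 2).
assert (hs : 1 / 2 <= s).
{ unfold s; rewrite <- sqrt_1; apply Rmult_le_compat_r; [lra|apply sqrt_le_1; lra]. }
assert (hss : s * s = PI / 4).
{ unfold s; replace (sqrt PI / 2 * (sqrt PI / 2)) with (sqrt PI * sqrt PI / 4) by field.
  rewrite sqrt_sqrt by lra; reflexivity. }
apply filterlim_locally; intros eps.
destruct (gaussian_small 2 0 eps (cond_pos eps)) as [X HX].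
exists (Rmax 0 X); intros x hx.
assert (hx0 := Rle_lt_trans _ _ _ (Rmax_l _ _) hx).
assert (hx1 := Rle_lt_trans _ _ _ (Rmax_r _ _) hx).
assert (hF : 0 <= RInt (fun t => exp (- t ^ 2)) 0 x).
{ apply RInt_ge_0; [lra|apply ex_RInt_exp_opp_sqr|intros t _; apply Rlt_le, exp_pos]. }
assert (hsq := gauss_half_square x).
set (F := RInt _ 0 x) in *; set (G := RInt _ 0 1) in *.
assert (hC : ex_RInt (fun t => exp (- (x ^ 2 * (1 + t ^ 2))) / (1 + t ^ 2)) 0 1).
{ apply (ex_RInt_continuous (V := R_CompleteNormedModule)); intros t _.
  apply (ex_derive_continuous (V := R_NormedModule)); auto_derive; nra. }
assert (hG : 0 <= G).
{ apply RInt_ge_0; [lra|exact hC|intros t _].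
  apply Rlt_le, Rdiv_lt_0_compat; [apply exp_pos|nra]. }
assert (hG1 : G <= exp (- x ^ 2)).
{ replace (exp (- x ^ 2)) with (RInt (fun _ => exp (- x ^ 2)) 0 1).
  - apply RInt_le; [lra|exact hC|apply ex_RInt_const|intros t _].
    apply Rle_trans with (exp (- (x ^ 2 * (1 + t ^ 2)))).
    + apply Rle_div_l; [nra|].
      generalize (exp_pos (- (x ^ 2 * (1 + t ^ 2)))) (pow2_ge_0 t); nra.
    + apply exp_le_exp; generalize (pow2_ge_0 t) (pow2_ge_0 x); nra.
  - rewrite RInt_const; unfold scal; cbn; unfold mult; cbn; ring. }
assert (h := HX x ltac:(generalize (Rle_abs x); lra)).
rewrite Rmult_0_l, Rplus_0_r in h.
change (Rabs (F - s) < eps).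
assert (hd : (s - F) * (s + F) = G) by (replace ((s - F) * (s + F)) with (s * s - F ^ 2) by ring;
  lra).
assert (hFs : 0 <= s - F).
{ destruct (Rle_lt_dec 0 (s - F)) as [hh|hh]; [exact hh|exfalso].
  assert (0 < (F - s) * (s + F)) by (apply Rmult_lt_0_compat; lra); lra. }
assert (hd' : (s - F) * (1 / 2) <= (s - F) * (s + F)) by (apply Rmult_le_compat_l; lra).
apply Rabs_lt_between; lra.
Qed.

Lemma gauss_integral :
  is_RInt_gen (fun x => exp (- x ^ 2)) (Rbar_locally m_infty) (Rbar_locally p_infty) (sqrt PI).
Proof.
set (F := fun x => RInt (fun t => exp (- t ^ 2)) 0 x).
assert (HF : is_lim F p_infty (sqrt PI / 2)) by exact gauss_half_line.
assert (odd : forall x, F (- x) = - F x).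
{ intros x; apply (is_RInt_unique (V := R_CompleteNormedModule)).
  apply is_RInt_ext with (fun t => opp (opp (exp (- (- t) ^ 2)))).
  { intros t _; rewrite opp_opp; f_equal; ring. }
  apply (is_RInt_opp (V := R_NormedModule)), (is_RInt_comp_opp (V := R_NormedModule)
    (fun t => exp (- t ^ 2))).
  rewrite Ropp_0, Ropp_involutive.
  apply (RInt_correct (V := R_CompleteNormedModule)), ex_RInt_exp_opp_sqr. }
assert (HFm : is_lim F m_infty (- (sqrt PI / 2))).
{ apply is_lim_ext with (fun x => - F (- x)).
  { intros x; rewrite odd; ring. }
  apply (is_lim_opp _ _ (sqrt PI / 2)).
  apply is_lim_comp with p_infty; [exact HF| |].
  - apply (is_lim_opp (fun x => x) m_infty m_infty), is_lim_id.
  - exists 0; intros y _; discriminate. }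
apply (filterlimi_lim_ext (fun ab => F (snd ab) - F (fst ab))).
- intros [a b]; cbn [fst snd].
  replace (F b - F a) with (plus (opp (F a)) (F b)) by (change (- F a + F b = F b - F a); ring).
  apply (is_RInt_Chasles (V := R_NormedModule)) with 0.
  + apply (is_RInt_swap (V := R_NormedModule)).
    apply (RInt_correct (V := R_CompleteNormedModule)), ex_RInt_exp_opp_sqr.
  + apply (RInt_correct (V := R_CompleteNormedModule)), ex_RInt_exp_opp_sqr.
- replace (sqrt PI) with (sqrt PI / 2 + - - (sqrt PI / 2)) by field.
  apply filterlim_comp_2 with
    (3 := filterlim_plus (V := R_NormedModule) (sqrt PI / 2) (- - (sqrt PI / 2))).
  + eapply filterlim_comp; [apply filterlim_snd|exact HF].
  + eapply filterlim_comp; [|exact (filterlim_opp (V := R_NormedModule) (- (sqrt PI / 2)))].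
    eapply filterlim_comp; [apply filterlim_fst|exact HFm].
Qed.

(** If the derivative of f in the parameter is also the derivative of some h in x, then
    differentiating under the integral sign leaves only boundary terms. *)
Lemma is_derive_RInt_homotopy (f h df : R -> R -> R) (a b theta : R) :
  (forall u x, is_derive (fun v => f v x) u (df u x)) ->
  (forall u x, is_derive (h u) x (df u x)) ->
  (forall u x, continuity_2d_pt df u x) ->
  (forall u x, continuous (f u) x) ->
  is_derive (fun u => RInt (f u) a b) theta (h theta b - h theta a).
Proof.
intros Hf Hh Hdf Cf.
replace (h theta b - h theta a) with (RInt (fun x => Derive (fun u => f u x) theta) a b).
- apply (is_derive_RInt_param f).
  + apply filter_forall; intros u x _; eexists; apply Hf.
  + intros x _; apply continuity_2d_pt_ext with (2 := Hdf theta x).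
    intros u v; symmetry; apply is_derive_unique, Hf.
  + apply filter_forall; intros u.
    apply (ex_RInt_continuous (V := R_CompleteNormedModule)); intros; apply Cf.
- apply (is_RInt_unique (V := R_CompleteNormedModule)).
  apply is_RInt_ext with (df theta).
  { intros x _; symmetry; apply is_derive_unique, Hf. }
  apply (is_RInt_derive (V := R_CompleteNormedModule)); intros x _; [apply Hh|].
  generalize (proj1 (continuity_2d_pt_filterlim _ _ _) (Hdf theta x)); intros C.
  apply (continuous_comp_2 (U := R_UniformSpace) (fun _ => theta) (fun y => y) df).
  + apply continuous_const.
  + apply continuous_id.
  + exact C.
Qed.

(** Deformation of the contour, in real form: with h vanishing at both ends uniformly
    in the parameter, the integral over the line does not change along the family. *)
Lemma is_RInt_gen_homotopy (f h df : R -> R -> R) (l : R) :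
  (forall u x, is_derive (fun v => f v x) u (df u x)) ->
  (forall u x, is_derive (h u) x (df u x)) ->
  (forall u x, continuity_2d_pt df u x) ->
  (forall u x, continuous (f u) x) ->
  (forall eps, 0 < eps -> exists X, forall u x, 0 <= u <= 1 -> X < Rabs x -> Rabs (h u x) < eps) ->
  is_RInt_gen (f 0) (Rbar_locally m_infty) (Rbar_locally p_infty) l ->
  is_RInt_gen (f 1) (Rbar_locally m_infty) (Rbar_locally p_infty) l.
Proof.
intros Hf Hh Hdf Cf Hsmall; unfold is_RInt_gen; rewrite !filterlimi_locally; intros H eps.
(* Half of eps for the initial integral, a quarter for each of the two boundary terms. *)
destruct (Hsmall (eps / 4)) as [X HX]; [generalize (cond_pos eps); lra|].
assert (HX' : filter_prod (Rbar_locally m_infty) (Rbar_locally p_infty)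
  (fun ab => X < Rabs (fst ab) /\ X < Rabs (snd ab))).
{ apply Filter_prod with (fun a => a < - Rabs X) (fun b => Rabs X < b).
  - exists (- Rabs X); auto.
  - exists (Rabs X); auto.
  - intros a b ha hb; cbn.
    generalize (Rle_abs X) (Rle_abs b) (Rle_abs (- a)); rewrite Rabs_Ropp; lra. }
generalize (filter_and _ _ (H (pos_div_2 eps)) HX'); apply filter_imp.
intros [a b]; cbn [fst snd]; intros [[z [Hz Bz]] [ha hb]].
exists (RInt (f 1) a b); split.
{ apply (RInt_correct (V := R_CompleteNormedModule)).
  apply (ex_RInt_continuous (V := R_CompleteNormedModule)); intros; apply Cf. }
destruct (MVT_gen (fun u => RInt (f u) a b) 0 1 (fun u => h u b - h u a)) as [c [hc E]].
- intros u _; apply (is_derive_RInt_homotopy f h df); assumption.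
- intros u _; apply continuity_pt_filterlim, (ex_derive_continuous (V := R_NormedModule)
    (fun u => RInt (f u) a b)).
  eexists; apply (is_derive_RInt_homotopy f h df); assumption.
- rewrite Rmin_left, Rmax_right in hc by lra.
  cbn beta in E; rewrite (is_RInt_unique (V := R_CompleteNormedModule) _ _ _ _ Hz) in E.
  assert (h1 := HX c a hc ha); assert (h2 := HX c b hc hb).
  change (Rabs (z - l) < eps / 2) in Bz; change (Rabs (RInt (f 1) a b - l) < eps).
  apply Rabs_lt_between in h1, h2, Bz; apply Rabs_lt_between; lra.
Qed.

(** Complete the square, -x^2 + kappa x = -(x - lam)^2 + lam^2 with lam = kappa/2, and
    move the centre of the Gaussian from 0 to lam along u lam, 0 <= u <= 1.  With
    E u x = exp(-(x - u lam)^2), the derivative of E in u is the derivative of -lam E in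
    x, so the homotopy lemma applies to the real and imaginary parts. *)
Lemma is_int_gauss_complex (kappa : C) :
  is_int (fun x => Cexp (- (RtoC x * RtoC x) + kappa * RtoC x)%C)
    (sqrt PI * Cexp (kappa * kappa / 4))%C.
Proof.
set (lam := (kappa / 2)%C).
set (E := fun u x : R => Cexp (- ((RtoC x - RtoC u * lam) * (RtoC x - RtoC u * lam)))).
set (h := fun u x => (- lam * E u x)%C).
set (dE := fun u x => (2 * lam * (RtoC x - RtoC u * lam) * E u x)%C).
assert (D1 : forall u x : R, is_derive_RC (fun v => E v x) u (dE u x)).
{ intros u x; unfold dE, E.
  assert (D : is_derive_RC (fun v : R => (RtoC x + RtoC v * - lam)%C) u (- lam)%C).
  { evar_last.
    { apply is_derive_Cplus; [apply is_derive_Cconst|].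
      apply is_derive_Cmult; [|apply is_derive_Cconst].
      apply is_derive_RtoC, (is_derive_id (K := R_AbsRing)). }
    change (0 + (1 * - lam + RtoC u * 0) = - lam)%C; ring. }
  assert (D2 := is_derive_Cmult _ _ _ _ _ (is_derive_Cconst (- (1))%C u)
    (is_derive_Cmult _ _ _ _ _ D D)).
  apply is_derive_Cexp in D2.
  replace (2 * lam * (RtoC x - RtoC u * lam) *
      Cexp (- ((RtoC x - RtoC u * lam) * (RtoC x - RtoC u * lam))))%C with
   ((RtoC 0 * ((RtoC x + RtoC u * - lam) * (RtoC x + RtoC u * - lam)) + - (1) *
      (- lam * (RtoC x + RtoC u * - lam) + (RtoC x + RtoC u * - lam) * - lam)) *
     Cexp (- (1) * ((RtoC x + RtoC u * - lam) * (RtoC x + RtoC u * - lam))))%C.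
  - apply is_derive_ext with (2 := D2); intros t; f_equal; ring.
  - f_equal; [|f_equal]; ring. }
assert (D2 : forall u x : R, is_derive_RC (h u) x (dE u x)).
{ intros u x; unfold h, dE, E.
  assert (D : is_derive_RC (fun y : R => (RtoC y + - (RtoC u * lam))%C) x (RtoC 1)).
  { evar_last.
    { apply is_derive_Cplus; [|apply is_derive_Cconst].
      apply is_derive_RtoC, (is_derive_id (K := R_AbsRing)). }
    change (1 + 0 = 1)%C; ring. }
  assert (D2 := is_derive_Cmult _ _ _ _ _ (is_derive_Cconst (- (1))%C x)
    (is_derive_Cmult _ _ _ _ _ D D)).
  apply is_derive_Cexp in D2.
  assert (D3 := is_derive_Cmult _ _ _ _ _ (is_derive_Cconst (- lam)%C x) D2).
  evar_last.
  { apply is_derive_ext with (2 := D3); intros t; cbn beta; f_equal; f_equal; ring. }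
  cbn beta.
  replace (- (1) * ((RtoC x + - (RtoC u * lam)) * (RtoC x + - (RtoC u * lam))))%C with
   (- ((RtoC x - RtoC u * lam) * (RtoC x - RtoC u * lam)))%C by ring.
  C_change; ring. }
assert (cont : forall u x, continuity_2d_pt (fun u x => fst (dE u x)) u x /\
   continuity_2d_pt (fun u x => snd (dE u x)) u x).
{ intros u x; unfold dE, E, Cexp, Re, Im; cbn -[Rmult Rplus Ropp].
  split;
  repeat first [apply continuity_2d_pt_const
        | apply continuity_2d_pt_id1 | apply continuity_2d_pt_id2
        | apply continuity_2d_pt_mult | apply continuity_2d_pt_minus
        | apply continuity_2d_pt_plus | apply continuity_2d_pt_opp
        | apply (continuity_1d_2d_pt_comp exp); [apply derivable_continuous, derivable_exp|]
        | apply (continuity_1d_2d_pt_comp cos); [apply continuity_cos|]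
        | apply (continuity_1d_2d_pt_comp sin); [apply continuity_sin|]]. }
assert (small : forall eps, 0 < eps -> exists X, forall u x,
   0 <= u <= 1 -> X < Rabs x -> Cmod (h u x) < eps).
{ intros eps heps.
  destruct (gaussian_small (Cmod lam * exp (snd lam ^ 2)) (2 * Rabs (fst lam)) eps heps) as [X HX].
  exists X; intros u x hu hx.
  apply Rle_lt_trans with (2 := HX x hx).
  unfold h, E; rewrite Cmod_mult, Cmod_opp, Cmod_Cexp, Rmult_assoc, <- exp_plus.
  apply Rmult_le_compat_l; [apply Cmod_ge_0|]; apply exp_le_exp.
  replace (Re (- ((RtoC x - RtoC u * lam) * (RtoC x - RtoC u * lam))))
    with (- x ^ 2 + 2 * (u * (fst lam * x)) - u * u * (fst lam * fst lam) +
      u * u * (snd lam * snd lam))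
    by (generalize lam; intros l; cbn; ring).
  assert (h1 : fst lam * x <= Rabs (fst lam) * Rabs x).
  { rewrite <- Rabs_mult; apply Rle_abs. }
  assert (h2 : u * (fst lam * x) <= Rabs (fst lam) * Rabs x).
  { apply Rle_trans with (u * (Rabs (fst lam) * Rabs x)).
    - apply Rmult_le_compat_l; lra.
    - generalize (Rmult_le_pos _ _ (Rabs_pos (fst lam)) (Rabs_pos x)); nra. }
  assert (h3 : u * u <= 1) by nra.
  assert (h4 : (u * u) * (snd lam * snd lam) <= snd lam * snd lam).
  { generalize (Rle_0_sqr (snd lam)); unfold Rsqr; nra. }
  assert (h5 : 0 <= (u * u) * (fst lam * fst lam)).
  { apply Rmult_le_pos; [nra|apply Rle_0_sqr]. }
  replace (snd lam ^ 2) with (snd lam * snd lam) by ring; lra. }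
assert (contE : forall u x, continuous (fun y => fst (E u y)) x /\
   continuous (fun y => snd (E u y)) x).
{ intros u x; unfold E, Cexp, Re, Im; cbn -[Rmult Rplus Ropp].
  split; apply (ex_derive_continuous (V := R_NormedModule)); auto_derive; exact I. }
assert (H1 : is_int (E 1) (RtoC (sqrt PI))).
{ apply is_int_comp_C; split.
  - apply (is_RInt_gen_homotopy (fun u x => fst (E u x)) (fun u x => fst (h u x))
      (fun u x => fst (dE u x))).
    + intros u x; exact (proj1 (proj1 (is_derive_C_iff _ _ _) (D1 u x))).
    + intros u x; exact (proj1 (proj1 (is_derive_C_iff _ _ _) (D2 u x))).
    + intros u x; exact (proj1 (cont u x)).
    + intros u x; exact (proj1 (contE u x)).
    + intros eps heps; destruct (small eps heps) as [X HX]; exists X; intros u x hu hx.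
      apply Rle_lt_trans with (2 := HX u x hu hx), re_le_Cmod.
    + apply is_RInt_gen_ext with (2 := gauss_integral).
      apply filter_forall; intros ab x _; unfold E.
      replace (- ((RtoC x - 0 * lam) * (RtoC x - 0 * lam)))%C with (RtoC (- x ^ 2)).
      * rewrite Cexp_RtoC; reflexivity.
      * apply injective_projections; cbn; ring.
  - apply (is_RInt_gen_homotopy (fun u x => snd (E u x)) (fun u x => snd (h u x))
      (fun u x => snd (dE u x))).
    + intros u x; exact (proj2 (proj1 (is_derive_C_iff _ _ _) (D1 u x))).
    + intros u x; exact (proj2 (proj1 (is_derive_C_iff _ _ _) (D2 u x))).
    + intros u x; exact (proj2 (cont u x)).
    + intros u x; exact (proj2 (contE u x)).
    + intros eps heps; destruct (small eps heps) as [X HX]; exists X; intros u x hu hx.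
      apply Rle_lt_trans with (2 := HX u x hu hx).
      eapply Rle_trans; [|apply Rmax_Cmod]; apply Rmax_r.
    + replace (snd (RtoC (sqrt PI))) with (scal 0 (sqrt PI)) by (cbn; unfold scal; cbn;
        unfold mult; cbn; ring).
      apply is_RInt_gen_ext with (2 := is_RInt_gen_scal (V := R_NormedModule) _ 0 _ gauss_integral).
      apply filter_forall; intros ab x _; unfold E.
      replace (- ((RtoC x - 0 * lam) * (RtoC x - 0 * lam)))%C with (RtoC (- x ^ 2)).
      * rewrite Cexp_RtoC; unfold scal; cbn; unfold mult; cbn; ring.
      * apply injective_projections; cbn; ring. }
apply (is_int_Cmult (Cexp (kappa * kappa / 4))) in H1.
rewrite Cmult_comm.
apply is_int_ext with (2 := H1); intros x.
unfold E; rewrite <- Cexp_plus; f_equal; unfold lam; field.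
Qed.

(** * Hermite polynomials *)

Lemma hermite_0 (x : R) : hermite 0 x = 1.
Proof.
assert (H := is_pseries_unique _ _ _ (hermiteP x 0)).
rewrite PSeries_0 in H; cbn in H.
rewrite Rdiv_1_r in H; rewrite H.
replace (2 * x * 0 - 0 * (0 * 1)) with 0 by ring; apply exp_0.
Qed.

(** Compare coefficients in d/dz exp(2xz - z^2) = (2x - 2z) exp(2xz - z^2).  For m = 0
    the last term carries the factor INR 0. *)
Lemma hermite_S (m : nat) (x : R) :
  hermite (S m) x = 2 * x * hermite m x - 2 * INR m * hermite (pred m) x.
Proof.
set (a := fun m => hermite m x / INR (fact m)).
assert (Ha : forall z, is_pseries a z (exp (2 * x * z - z ^ 2))) by apply hermiteP.
assert (ra := pseries_everywhere_radius _ _ Ha).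
(* The coefficients of (2x - 2z) exp(2xz - z^2). *)
set (b := PS_plus (PS_scal (2 * x) a) (PS_scal (-2) (PS_incr_1 a))).
assert (Hb : forall z, is_pseries b z ((2 * x - 2 * z) * exp (2 * x * z - z ^ 2))).
{ intros z.
  replace ((2 * x - 2 * z) * exp (2 * x * z - z ^ 2)) with
    (plus (scal (2 * x) (exp (2 * x * z - z ^ 2)))
      (scal (-2) (scal z (exp (2 * x * z - z ^ 2))))).
  - apply (is_pseries_plus (V := R_NormedModule)); apply (is_pseries_scal (V := R_NormedModule));
      try apply Rmult_comm.
    + apply Ha.
    + apply (is_pseries_incr_1 (V := R_NormedModule)), Ha.
  - unfold plus, scal; cbn; unfold mult; cbn; ring. }
assert (E : PS_derive a m = b m).
{ apply PSeries_ext_recip.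
  - rewrite CV_radius_derive, <- Rabs_R0; apply ra.
  - rewrite <- Rabs_R0; apply (pseries_everywhere_radius _ _ Hb).
  - apply filter_forall; intros z.
    rewrite <- Derive_PSeries by apply ra.
    rewrite (is_pseries_unique _ _ _ (Hb z)).
    apply is_derive_unique, is_derive_ext with (fun z => exp (2 * x * z - z ^ 2)).
    + intros t; symmetry; apply is_pseries_unique, Ha.
    + auto_derive; [exact I|]. unfold Rminus; cbn [pow]; ring. }
unfold PS_derive, b, PS_plus, PS_scal, PS_incr_1, a in E.
destruct m as [|m].
- cbn in E |- *; unfold plus, scal, zero in E; cbn in E; unfold mult in E; cbn in E.
  rewrite Rmult_0_r, Rplus_0_r in E; lra.
- unfold plus, scal in E; cbn [plus scal] in E; unfold mult in E; cbn [mult] in E.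
  change (INR (S (S m)) * (hermite (S (S m)) x / INR (fact (S (S m)))) =
    2 * x * (hermite (S m) x / INR (fact (S m))) + -2 * (hermite m x / INR (fact m))) in E.
  rewrite (fact_simpl (S m)), (fact_simpl m), !mult_INR in E.
  assert (h0 := INR_fact_neq_0 m).
  assert (h1 := not_0_INR (S m) ltac:(lia)); assert (h2 := not_0_INR (S (S m)) ltac:(lia)).
  cbn [pred]; set (u := INR (S (S m))) in *; set (v := INR (S m)) in *;
    set (w := INR (fact m)) in *.
  apply (Rmult_eq_reg_r (/ (v * w))); [|apply Rinv_neq_0_compat, Rmult_integral_contrapositive;
    auto].
  replace (hermite (S (S m)) x * / (v * w)) with (u * (hermite (S (S m)) x / (u * (v * w))))
    by (field; auto).
  rewrite E; field; auto.
Qed.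

(** Differentiate [hermite_S]; the recursion has depth two, hence so has the
    induction. *)
Lemma is_derive_hermite (m : nat) (x : R) :
  is_derive (hermite m) x (2 * INR m * hermite (pred m) x).
Proof.
assert (D0 : forall x, is_derive (hermite 0) x (2 * INR 0 * hermite (pred 0) x)).
{ intros y; apply is_derive_ext with (fun _ => 1).
  - intros t; symmetry; apply hermite_0.
  - replace (2 * INR 0 * hermite (pred 0) y) with 0 by (cbn; ring).
    apply (is_derive_const (V := R_NormedModule)). }
revert x; cut ((forall x, is_derive (hermite m) x (2 * INR m * hermite (pred m) x)) /\
  (forall x, is_derive (hermite (S m)) x (2 * INR (S m) * hermite m x))); [tauto|].
induction m as [|m [IH1 IH2]]; (split; [assumption|]); intros x;
  eapply is_derive_ext; try (intros t; symmetry; apply hermite_S).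
- auto_derive.
  + repeat split; eexists; apply D0.
  + change (fun x => hermite 0 x) with (hermite 0).
    rewrite (is_derive_unique _ _ _ (D0 x)), hermite_0; cbn; ring.
- auto_derive.
  + split; [eexists; apply IH2|split; [eexists; apply IH1|exact I]].
  + change (fun x => hermite (S m) x) with (hermite (S m)).
    change (fun x => hermite m x) with (hermite m).
    rewrite (is_derive_unique _ _ _ (IH1 x)), (is_derive_unique _ _ _ (IH2 x)).
    rewrite (hermite_S m); change (match m with O => 1 | S _ => INR m + 1 end) with (INR (S m));
      rewrite !S_INR; ring.
Qed.

(** Exponential growth is a crude bound, but it is preserved by the recursion (because
    |x| <= exp |x|) and by translations, and a Gaussian beats it. *)
Lemma hermite_growth (m : nat) :
  exists K k, 0 <= K /\ 0 <= k /\ forall x, Rabs (hermite m x) <= K * exp (k * Rabs x).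
Proof.
cut ((exists K k, 0 <= K /\ 0 <= k /\ forall x, Rabs (hermite m x) <= K * exp (k * Rabs x)) /\
 (exists K k, 0 <= K /\ 0 <= k /\ forall x, Rabs (hermite (S m) x) <= K * exp (k * Rabs x)));
   [tauto|].
assert (step : forall m,
 (exists K k, 0 <= K /\ 0 <= k /\ forall x, Rabs (hermite (pred m) x) <= K * exp (k * Rabs x)) ->
 (exists K k, 0 <= K /\ 0 <= k /\ forall x, Rabs (hermite m x) <= K * exp (k * Rabs x)) ->
 (exists K k, 0 <= K /\ 0 <= k /\ forall x, Rabs (hermite (S m) x) <= K * exp (k * Rabs x))).
{ intros n [K [k [hK [hk H]]]] [K' [k' [hK' [hk' H']]]].
  assert (hn := pos_INR n).
  exists (2 * K' + 2 * INR n * K), (1 + k + k'); repeat split; [nra|lra|].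
  intros x; rewrite hermite_S.
  assert (hx := Rabs_pos x).
  apply Rle_trans with (1 := Rabs_triang _ _).
  rewrite Rabs_Ropp, !Rabs_mult, (Rabs_pos_eq 2), (Rabs_pos_eq (INR n)) by lra.
  rewrite Rmult_plus_distr_r.
  assert (e1 : Rabs x * exp (k' * Rabs x) <= exp ((1 + k + k') * Rabs x)).
  { apply Rle_trans with (exp (Rabs x) * exp (k' * Rabs x)).
    - apply Rmult_le_compat_r; [apply Rlt_le, exp_pos|].
      generalize (exp_ineq1_le (Rabs x)); lra.
    - rewrite <- exp_plus; apply exp_le_exp; nra. }
  assert (e2 : exp (k * Rabs x) <= exp ((1 + k + k') * Rabs x)) by (apply exp_le_exp; nra).
  apply Rplus_le_compat.
  - apply Rle_trans with (2 * Rabs x * (K' * exp (k' * Rabs x))).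
    + apply Rmult_le_compat_l; [lra|apply H'].
    + replace (2 * Rabs x * (K' * exp (k' * Rabs x)))
        with (2 * K' * (Rabs x * exp (k' * Rabs x))) by ring.
      apply Rmult_le_compat_l; [lra|exact e1].
  - rewrite Rmult_assoc, (Rmult_assoc 2), (Rmult_assoc 2), Rmult_assoc.
    apply Rmult_le_compat_l; [lra|]; apply Rmult_le_compat_l; [lra|].
    apply Rle_trans with (1 := H x), Rmult_le_compat_l; [lra|exact e2]. }
assert (base : exists K k, 0 <= K /\ 0 <= k /\ forall x,
  Rabs (hermite 0 x) <= K * exp (k * Rabs x)).
{ exists 1, 0; repeat split; [lra|lra|intros x].
  rewrite hermite_0, Rmult_0_l, exp_0, Rabs_R1; lra. }
induction m as [|m [IH1 IH2]]; (split; [assumption|]); apply step; assumption.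
Qed.

(** * Gaussian integrals of products of two Hermite polynomials *)

Definition herm_gauss (kappa : C) (p q : R) (m n : nat) (x : R) : C :=
  (Cexp (- (RtoC x * RtoC x) + kappa * RtoC x) * RtoC (hermite m (p - x) * hermite n (q - x)))%C.

Definition herm_gauss' (kappa : C) (p q : R) (m n : nat) (x : R) : C :=
  ((kappa - 2 * RtoC x) * herm_gauss kappa p q m n x
   - 2 * RtoC (INR m) * herm_gauss kappa p q (pred m) n x
   - 2 * RtoC (INR n) * herm_gauss kappa p q m (pred n) x)%C.

Lemma is_derive_herm_gauss kappa p q m n x :
  is_derive_RC (herm_gauss kappa p q m n) x (herm_gauss' kappa p q m n x).
Proof.
assert (DH : is_derive (fun x => hermite m (p - x) * hermite n (q - x)) x
  (- (2 * INR m) * (hermite (pred m) (p - x) * hermite n (q - x))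
   - 2 * INR n * (hermite m (p - x) * hermite (pred n) (q - x)))).
{ auto_derive.
  - split; [eexists; apply is_derive_hermite|split; [eexists; apply is_derive_hermite|exact I]].
  - change (fun x => hermite m x) with (hermite m); change (fun x => hermite n x) with (hermite n).
    rewrite (is_derive_unique _ _ _ (is_derive_hermite m _)),
      (is_derive_unique _ _ _ (is_derive_hermite n _)); unfold Rminus; ring. }
assert (DE : is_derive_RC (fun x => - (RtoC x * RtoC x) +
  kappa * RtoC x)%C x (kappa - 2 * RtoC x)%C).
{ assert (I := is_derive_RtoC _ x _ (is_derive_id (K := R_AbsRing) x)); cbn beta in I.
  assert (D := is_derive_Cplus _ _ _ _ _
    (is_derive_Cmult _ _ _ _ _ (is_derive_Cconst (- (1))%C x) (is_derive_Cmult _ _ _ _ _ I I))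
    (is_derive_Cmult _ _ _ _ _ (is_derive_Cconst kappa x) I)).
  evar_last.
  { apply is_derive_ext with (2 := D); intros t; cbn beta; f_equal; ring. }
  cbn beta; change (@one R_AbsRing) with 1.
  C_change; ring. }
evar_last; [exact (is_derive_Cmult _ _ _ _ _ (is_derive_Cexp _ _ _ DE) (is_derive_RtoC _ _ _ DH))|].
unfold herm_gauss', herm_gauss; cbn beta.
rewrite !RtoC_minus, !RtoC_mult, !RtoC_opp, !RtoC_mult.
C_change; ring.
Qed.

Lemma herm_gauss_bound kappa p q m n :
  exists K k, forall x, Cmod (herm_gauss kappa p q m n x) <= K * exp (- x ^ 2 + k * Rabs x).
Proof.
destruct (hermite_growth m) as [K1 [k1 [hK1 [hk1 H1]]]].
destruct (hermite_growth n) as [K2 [k2 [hK2 [hk2 H2]]]].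
assert (tr : forall K k f p, 0 <= K -> 0 <= k -> (forall x, Rabs (f x) <= K * exp (k * Rabs x)) ->
  forall x, Rabs (f (p - x)) <= (K * exp (k * Rabs p)) * exp (k * Rabs x)).
{ intros K k f c hK hk H x; apply Rle_trans with (1 := H _).
  rewrite Rmult_assoc, <- exp_plus; apply Rmult_le_compat_l; [exact hK|]; apply exp_le_exp.
  generalize (Rabs_triang c (- x)); rewrite Rabs_Ropp; fold (c - x); nra. }
exists ((K1 * exp (k1 * Rabs p)) * (K2 * exp (k2 * Rabs q))), (Rabs (fst kappa) + k1 + k2).
intros x; unfold herm_gauss; rewrite Cmod_mult, Cmod_Cexp, Cmod_R, Rabs_mult.
apply Rle_trans with (exp (- x ^ 2 + Rabs (fst kappa) * Rabs x) *
  ((K1 * exp (k1 * Rabs p)) * exp (k1 * Rabs x) * ((K2 * exp (k2 * Rabs q)) * exp (k2 * Rabs x)))).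
- apply Rmult_le_compat; [apply Rlt_le, exp_pos|apply Rmult_le_pos; apply Rabs_pos| |].
  + apply exp_le_exp.
    replace (Re (- (RtoC x * RtoC x) + kappa * RtoC x)) with (- x ^ 2 + fst kappa * x) by (cbn;
      ring).
    generalize (Rle_abs (fst kappa * x)); rewrite Rabs_mult; lra.
  + apply Rmult_le_compat; [apply Rabs_pos|apply Rabs_pos|apply tr|apply tr]; assumption.
- apply Req_le.
  replace (- x ^ 2 + (Rabs (fst kappa) + k1 + k2) * Rabs x) with
   ((- x ^ 2 + Rabs (fst kappa) * Rabs x) + k1 * Rabs x + k2 * Rabs x) by ring.
  rewrite 2!(exp_plus (_ + _)); ring.
Qed.

(** The integration by parts behind the recursion: the primitive [herm_gauss] tends to 0
    at both ends. *)
Lemma is_int_herm_gauss' kappa p q m n : is_int (herm_gauss' kappa p q m n) (RtoC 0).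
Proof.
destruct (herm_gauss_bound kappa p q m n) as [K [k HB]].
destruct (filterlim_gaussian_bound _ _ _ HB) as [Hm Hp].
replace (RtoC 0) with (0 - 0)%C by ring.
apply is_int_derive with (herm_gauss kappa p q m n); [| |assumption|assumption].
- apply is_derive_herm_gauss.
- intros x; apply (ex_derive_continuous (V := C_R_NormedModule)).
  assert (I := is_derive_RtoC _ x _ (is_derive_id (K := R_AbsRing) x)); cbn beta in I.
  assert (D1 := is_derive_Cplus _ _ _ _ _ (is_derive_Cconst kappa x)
    (is_derive_Cmult _ _ _ _ _ (is_derive_Cconst (- (2))%C x) I)).
  assert (D := is_derive_Cplus _ _ _ _ _
    (is_derive_Cplus _ _ _ _ _
      (is_derive_Cmult _ _ _ _ _ D1 (is_derive_herm_gauss kappa p q m n x))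
      (is_derive_Cmult _ _ _ _ _ (is_derive_Cconst (- (2 * RtoC (INR m)))%C x)
        (is_derive_herm_gauss kappa p q (pred m) n x)))
    (is_derive_Cmult _ _ _ _ _ (is_derive_Cconst (- (2 * RtoC (INR n)))%C x)
      (is_derive_herm_gauss kappa p q m (pred n) x))).
  eexists; apply is_derive_ext with (2 := D); intros t; unfold herm_gauss'; cbn beta.
  C_change; ring.
Qed.

(** * Sums of complex numbers weighted by binomial coefficients *)

Local Notation binom n k := (INR (binomial.binomial n k)).

Lemma binom_0_r n : binom n 0 = 1.
Proof. now rewrite binomial.bin0. Qed.

Lemma binom_0_S k : binom 0 (S k) = 0.
Proof. reflexivity. Qed.

Lemma binom_S_S n k : binom (S n) (S k) = binom n (S k) + binom n k.
Proof. rewrite binomial.binS; apply plus_INR. Qed.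

Lemma binom_gt n k : (n < k)%nat -> binom n k = 0.
Proof.
intros h; rewrite binomial.bin_small; [reflexivity|].
apply (ssrbool.introT ssrnat.ltP), h.
Qed.

Local Notation Csum := (sum_n (G := C_AbelianMonoid)).

Lemma Csum_S u n : Csum u (S n) = (Csum u n + u (S n))%C.
Proof. apply (sum_Sn (G := C_AbelianMonoid)). Qed.

Lemma Csum_shift u n : Csum u (S n) = (u O + Csum (fun j => u (S j)) n)%C.
Proof.
induction n as [|n IH].
- rewrite Csum_S, !sum_O; reflexivity.
- rewrite Csum_S, IH, Csum_S; C_change; ring.
Qed.

Lemma Csum_mult_l c u n : Csum (fun j => c * u j)%C n = (c * Csum u n)%C.
Proof.
induction n as [|n IH]; [rewrite !sum_O; reflexivity|rewrite !Csum_S, IH; C_change; ring].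
Qed.

Lemma Csum_plus u v n : Csum (fun j => u j + v j)%C n = (Csum u n + Csum v n)%C.
Proof. apply (sum_n_plus (G := C_AbelianMonoid)). Qed.

(** Pascal's rule: the weights of row m + 1 are those of row m, once in place and once
    shifted. *)
Lemma Csum_binom_S (u : nat -> C) (m : nat) :
  Csum (fun j => binom (S m) j * u j)%C (S m) =
  (Csum (fun j => binom m j * u (S j)) m + Csum (fun j => binom m j * u j) m)%C.
Proof.
assert (E : Csum (fun j => binom m j * u j)%C m = Csum (fun j => binom m j * u j)%C (S m)).
{ rewrite Csum_S, binom_gt, Cmult_0_l, Cplus_0_r by lia; reflexivity. }
rewrite E, !Csum_shift, !binom_0_r.
rewrite (sum_n_ext (G := C_AbelianMonoid) (fun j => binom (S m) (S j) * u (S j))%C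
  (fun j => binom m (S j) * u (S j) + binom m j * u (S j))%C).
- rewrite Csum_plus; C_change; ring.
- intros j; rewrite binom_S_S, RtoC_plus; C_change; ring.
Qed.

(** The solution of the recursion M(m+1,n) = A M(m,n) + 2n M(m,n-1),
    M(0,n+1) = B M(0,n), M(0,0) = 1, is M(m,m+d) = 2^(m+d) (m+d)! [laguerre_sum A B m d].
    Indexing by d = n - m suffices to reach the diagonal, since the recursion leads from
    (m+1, d) to (m, d+1) and (m, d), and it avoids the boundary case n = 0. *)
Definition laguerre_sum (A B : C) (m d : nat) : C :=
  Csum (fun j => binom m j * (A ^ j * ((B / 2) ^ (d + j) / INR (fact (d + j)))))%C m.

Lemma laguerre_sum_S A B m d :
  laguerre_sum A B (S m) d = (A * laguerre_sum A B m (S d) + laguerre_sum A B m d)%C.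
Proof.
unfold laguerre_sum; rewrite Csum_binom_S, <- Csum_mult_l; f_equal.
apply (sum_n_ext (G := C_AbelianMonoid)); intros j.
replace (d + S j)%nat with (S d + j)%nat by lia; rewrite Cpow_S; C_change; ring.
Qed.

(** Pointwise, [herm_gauss] at (m+1, n) is A times its value at (m, n), plus 2n times its
    value at (m, n-1), plus the exact derivative [herm_gauss'], which integrates to 0.  The
    case m = 0 is settled by the same identity with the two polynomials exchanged. *)
Lemma is_int_herm_gauss (kappa : C) (p q : R) (m d : nat) :
  is_int (herm_gauss kappa p q m (m + d))
    (sqrt PI * Cexp (kappa * kappa / 4) * RtoC (2 ^ (m + d) * INR (fact (m + d))) *
       laguerre_sum (2 * RtoC p - kappa) (2 * RtoC q - kappa) m d)%C.
Proof.
set (A := (2 * RtoC p - kappa)%C); set (B := (2 * RtoC q - kappa)%C).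
set (M := (sqrt PI * Cexp (kappa * kappa / 4))%C).
revert d; induction m as [|m IH]; intros d.
- induction d as [|d IHd].
  + assert (H := is_int_gauss_complex kappa); fold M in H.
    replace (M * _ * _)%C with M.
    * apply is_int_ext with (2 := H); intros x; unfold herm_gauss; cbn [Nat.add].
      rewrite !hermite_0, Rmult_1_l; C_change; ring.
    * unfold laguerre_sum; rewrite sum_O, binom_0_r; cbn; rewrite !Rmult_1_l; field.
  + cbn [Nat.add] in *.
    assert (H := is_int_Cplus _ _ _ _ (is_int_Cmult B _ _ IHd) (is_int_herm_gauss' kappa p q 0 d)).
    replace (M * _ * _)%C with (B * (M * RtoC (2 ^ d * INR (fact d)) * laguerre_sum A B 0 d) + 0)%C.
    * apply is_int_ext with (2 := H); intros x; unfold herm_gauss', herm_gauss, B.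
      rewrite hermite_S, !RtoC_mult, !RtoC_minus, !RtoC_mult, !RtoC_minus; cbn [INR]; C_change;
        ring.
    * unfold laguerre_sum; rewrite !sum_O, !binom_0_r, !Nat.add_0_r, fact_simpl, mult_INR.
      cbn [pow]; rewrite !RtoC_mult, Cpow_S; field.
      split; [apply RtoC_INR_fact_neq_0|apply RtoC_INR_S_neq_0].
- assert (H := is_int_Cplus _ _ _ _ (is_int_Cplus _ _ _ _ (is_int_Cmult A _ _ (IH (S d)))
    (is_int_herm_gauss' kappa p q m (m + S d)))
    (is_int_Cmult (2 * RtoC (INR (S (m + d)))) _ _ (IH d))).
  rewrite laguerre_sum_S.
  replace (S m + d)%nat with (S (m + d)) by lia.
  replace (m + S d)%nat with (S (m + d)) in H by lia.
  replace (M * _ * _)%C with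
   (A * (M * RtoC (2 ^ S (m + d) * INR (fact (S (m + d)))) * laguerre_sum A B m (S d)) + 0 +
    2 * RtoC (INR (S (m + d))) *
      (M * RtoC (2 ^ (m + d) * INR (fact (m + d))) * laguerre_sum A B m d))%C.
  + apply is_int_ext with (2 := H); intros x; unfold herm_gauss', herm_gauss, A.
    rewrite (hermite_S m), !RtoC_mult, !RtoC_minus, !RtoC_mult, !RtoC_minus; cbn [pred];
      C_change; ring.
  + rewrite fact_simpl, mult_INR; cbn [pow]; rewrite !RtoC_mult; C_change; ring.
Qed.

(** * Dominated convergence for sums *)

(** Convergence in C expressed by a real sequence, so that squeezing and limits of
    real sequences apply to it directly. *)
Definition Clim (u : nat -> C) (l : C) : Prop :=
  is_lim_seq (fun N => Cmod (u N - l)) 0.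

Lemma is_lim_seq_0_le (u v : nat -> R) :
  (forall n, 0 <= u n <= v n) -> is_lim_seq v 0 -> is_lim_seq u 0.
Proof.
intros H Hv; apply is_lim_seq_le_le with (fun _ => 0) v; [exact H|apply is_lim_seq_const|exact Hv].
Qed.

Lemma is_lim_seq_scal_0 (c : R) (u : nat -> R) :
  is_lim_seq u 0 -> is_lim_seq (fun n => c * u n) 0.
Proof.
intros Hu; rewrite <- (Rmult_0_r c).
apply is_lim_seq_mult'; [apply is_lim_seq_const|exact Hu].
Qed.

Lemma Clim_filterlim (u : nat -> C) (l : C) :
  Clim u l -> filterlim u eventually (locally (T := C_NormedModule) l).
Proof.
intros H.
apply (filterlim_locally_ball_norm (U := C_NormedModule)); intros eps.
destruct (proj1 (filterlim_locally _ _) H eps) as [N HN].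
exists N; intros n hn; specialize (HN n hn).
change (Rabs (Cmod (u n - l) - 0) < eps) in HN; change (Cmod (u n - l) < eps).
rewrite Rminus_0_r, Rabs_pos_eq in HN by apply Cmod_ge_0; exact HN.
Qed.

Lemma sum_n_tail_small (W : nat -> R) (eps : R) : 0 < eps -> ex_series W ->
  exists J, forall n, (J <= n)%nat -> Rabs (sum_n W n - sum_n W J) < eps.
Proof.
intros heps [l Hl].
destruct (proj1 (filterlim_locally _ _) Hl (mkposreal (eps / 2) ltac:(lra))) as [J HJ].
exists J; intros n hn.
assert (h1 := HJ n hn); assert (h2 := HJ J (le_n _)).
change (Rabs (sum_n W n - l) < eps / 2) in h1; change (Rabs (sum_n W J - l) < eps / 2) in h2.
apply Rabs_lt_between in h1, h2; apply Rabs_lt_between; lra.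
Qed.

(** Split the sum at an index beyond which the tail of W is small; the finitely many
    remaining terms tend to 0 one by one. *)
Lemma tannery (d : nat -> nat -> R) (W : nat -> R) :
  (forall j N, 0 <= d j N <= W j) -> ex_series W ->
  (forall j, is_lim_seq (d j) 0) ->
  is_lim_seq (fun N => sum_n (fun j => d j N) N) 0.
Proof.
intros Hd HW Hlim.
assert (fin : forall J, is_lim_seq (fun N => sum_n (fun j => d j N) J) 0).
{ induction J as [|J IH].
  - apply is_lim_seq_ext with (2 := Hlim O); intros N; rewrite sum_O; reflexivity.
  - apply is_lim_seq_ext with (fun N => sum_n (fun j => d j N) J + d (S J) N).
    + intros N; rewrite sum_Sn; reflexivity.
    + replace 0 with (0 + 0) by ring; apply is_lim_seq_plus'; auto. }
assert (tail : forall J N k, sum_n (fun j => d j N) (J +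
  k) - sum_n (fun j => d j N) J <= sum_n W (J + k) - sum_n W J).
{ intros J N k; induction k as [|k IH]; [rewrite Nat.add_0_r; lra|].
  rewrite Nat.add_succ_r, !sum_Sn.
  unfold plus; cbn -[sum_n]; generalize (Hd (S (J + k)) N); lra. }
assert (pos : forall J N, 0 <= sum_n (fun j => d j N) J).
{ intros J N; induction J as [|J IH].
  - rewrite sum_O; apply Hd.
  - rewrite sum_Sn; unfold plus; cbn -[sum_n]; generalize (Hd (S J) N); lra. }
apply filterlim_locally; intros eps.
destruct (sum_n_tail_small W (eps / 2)) as [J HJ]; [generalize (cond_pos eps); lra|exact HW|].
destruct (proj1 (filterlim_locally _ _) (fin J) (pos_div_2 eps)) as [N0 HN0].
exists (max J N0); intros N hN.
assert (h1 := HN0 N ltac:(lia)); assert (h2 := HJ N ltac:(lia)).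
assert (h3 := tail J N (N - J)%nat); replace (J + (N - J))%nat with N in h3 by lia.
change (Rabs (sum_n (fun j => d j N) J - 0) < eps / 2) in h1.
change (Rabs (sum_n (fun j => d j N) N - 0) < eps).
assert (h4 := pos N N).
apply Rabs_lt_between in h1, h2; apply Rabs_lt_between; lra.
Qed.

Lemma Cmod_Csum_le (u : nat -> C) (n : nat) : Cmod (Csum u n) <= sum_n (fun j => Cmod (u j)) n.
Proof.
induction n as [|n IH]; [rewrite !sum_O; apply Rle_refl|].
rewrite Csum_S, sum_Sn; apply Rle_trans with (1 := Cmod_triangle _ _).
apply Rplus_le_compat_r, IH.
Qed.

(** * The complex exponential series *)

Lemma fst_Csum (u : nat -> C) (n : nat) : fst (Csum u n) = sum_n (fun j => fst (u j)) n.
Proof. induction n as [|n IH]; [rewrite !sum_O; reflexivity|rewrite Csum_S, sum_Sn, <- IH;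
  reflexivity]. Qed.

Lemma snd_Csum (u : nat -> C) (n : nat) : snd (Csum u n) = sum_n (fun j => snd (u j)) n.
Proof. induction n as [|n IH]; [rewrite !sum_O; reflexivity|rewrite Csum_S, sum_Sn, <- IH;
  reflexivity]. Qed.

Lemma is_pseries_dominated_exp (a : nat -> R) (r : R) :
  (forall j, Rabs (a j) <= r ^ j / INR (fact j)) ->
  forall t, is_pseries a t (PSeries a t).
Proof.
intros H t; apply PSeries_correct, ex_pseries_R.
apply (ex_series_le (V := R_CompleteNormedModule) _ (fun j => / INR (fact j) * (r * Rabs t) ^ j)).
- intros j; change (Rabs (a j * t ^ j) <= / INR (fact j) * (r * Rabs t) ^ j).
  rewrite Rabs_mult, Rpow_mult_distr, <- RPow_abs.
  replace (/ INR (fact j) * (r ^ j * Rabs t ^ j)) with (r ^ j / INR (fact j) * Rabs t ^ j)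
    by (unfold Rdiv; ring).
  apply Rmult_le_compat_r; [apply pow_le, Rabs_pos|apply H].
- eexists; apply is_pseries_R, is_exp_Reals.
Qed.

Lemma is_derive_RC_zero_const (f : R -> C) (t : R) :
  (forall x, is_derive_RC f x (RtoC 0)) -> f t = f 0.
Proof.
intros H.
assert (E : forall g : R -> R, (forall x, is_derive g x 0) -> g t = g 0).
{ intros g Hg; destruct (MVT_gen g 0 t (fun _ => 0)) as [c [_ Hc]].
  - intros x _; apply Hg.
  - intros x _; apply continuity_pt_filterlim, (ex_derive_continuous (V := R_NormedModule));
      eexists; apply Hg.
  - lra. }
apply injective_projections.
- apply (E (fun x => fst (f x))); intros x; exact (proj1 (proj1 (is_derive_C_iff _ _ _) (H x))).
- apply (E (fun x => snd (f x))); intros x; exact (proj2 (proj1 (is_derive_C_iff _ _ _) (H x))).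
Qed.

(** The components of sum_j y^j t^j / j! are real power series in the real variable t,
    and their sum Z satisfies Z' = y Z.  Hence Z(t) Cexp(-t y) is constant, equal to
    Z(0) = 1, and t = 1 gives the claim. *)
Lemma Cexp_series (y : C) : Clim (Csum (fun j => y ^ j / INR (fact j))%C) (Cexp y).
Proof.
set (a := fun j => fst (y ^ j / INR (fact j))%C).
set (b := fun j => snd (y ^ j / INR (fact j))%C).
assert (Ha : forall t, is_pseries a t (PSeries a t)).
{ apply is_pseries_dominated_exp with (Cmod y); intros j; rewrite <- Cmod_pow_over_fact;
    apply re_le_Cmod. }
assert (Hb : forall t, is_pseries b t (PSeries b t)).
{ apply is_pseries_dominated_exp with (Cmod y); intros j; rewrite <- Cmod_pow_over_fact.
  eapply Rle_trans; [|apply Rmax_Cmod]; apply Rmax_r. }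
assert (ra := pseries_everywhere_radius _ _ Ha).
assert (rb := pseries_everywhere_radius _ _ Hb).
assert (step : forall j, (RtoC (INR (S j)) * (y ^ S j / INR (fact (S j))) =
  y * (y ^ j / INR (fact j)))%C).
{ intros j; rewrite fact_simpl, mult_INR, RtoC_mult, Cpow_S; field.
  split; [apply RtoC_INR_fact_neq_0|apply RtoC_INR_S_neq_0]. }
set (Z := fun t : R => (PSeries a t, PSeries b t) : C).
assert (DZ : forall t, is_derive_RC Z t (y * Z t)%C).
{ intros t; apply is_derive_C_iff; split; cbn.
  - assert (E : PSeries (PS_derive a) t = fst y * PSeries a t + - snd y * PSeries b t).
    { apply is_pseries_unique.
      apply is_pseries_ext with (PS_plus (PS_scal (fst y) a) (PS_scal (- snd y) b)).
      - intros j; generalize (f_equal fst (step j)); unfold a, b, PS_derive, PS_plus, PS_scal.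
        intros e; transitivity (fst (y * (y ^ j / INR (fact j)))%C).
        + change (fst y * fst (y ^ j / INR (fact j))%C + - snd y * snd (y ^ j / INR (fact j))%C =
            fst y * fst (y ^ j / INR (fact j))%C - snd y * snd (y ^ j / INR (fact j))%C); ring.
        + rewrite <- e; change (INR (S j) * fst (y ^ S j / INR (fact (S j)))%C - 0 * snd
            (y ^ S j / INR (fact (S j)))%C = INR (S j) * fst (y ^ S j / INR (fact (S j)))%C); ring.
      - apply (is_pseries_plus (V := R_NormedModule));
          apply (is_pseries_scal (V := R_NormedModule)); try apply Rmult_comm; auto. }
    replace (fst y * PSeries a t - snd y * PSeries b t) with (PSeries (PS_derive a) t)
      by (rewrite E; ring).
    apply is_derive_PSeries, ra.
  - assert (E : PSeries (PS_derive b) t = fst y * PSeries b t + snd y * PSeries a t).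
    { apply is_pseries_unique.
      apply is_pseries_ext with (PS_plus (PS_scal (fst y) b) (PS_scal (snd y) a)).
      - intros j; generalize (f_equal snd (step j)); unfold a, b, PS_derive, PS_plus, PS_scal.
        intros e; transitivity (snd (y * (y ^ j / INR (fact j)))%C).
        + reflexivity.
        + rewrite <- e; change (INR (S j) * snd (y ^ S j / INR (fact (S j)))%C +
            0 * fst (y ^ S j / INR (fact (S j)))%C = INR (S j) * snd (y ^ S j / INR (fact
              (S j)))%C); ring.
      - apply (is_pseries_plus (V := R_NormedModule));
          apply (is_pseries_scal (V := R_NormedModule)); try apply Rmult_comm; auto. }
    rewrite <- E; apply is_derive_PSeries, rb. }
assert (HZ : Z 1 = Cexp y).
{ assert (H := is_derive_RC_zero_const (fun t => Z t * Cexp (RtoC t * - y))%C 1).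
  cbn beta in H; rewrite Cmult_1_l, Cmult_0_l, Cexp_0, Cmult_1_r in H.
  assert (HZ0 : Z 0 = 1).
  { unfold Z, a, b; rewrite !PSeries_0; apply injective_projections; cbn; field. }
  rewrite HZ0 in H.
  rewrite <- (Cmult_1_r (Z 1)), <- Cexp_0.
  replace (RtoC 0) with (- y + y)%C by ring.
  rewrite Cexp_plus, Cmult_assoc, H; [ring|].
  intros x; evar_last.
  - apply is_derive_Cmult; [apply DZ|].
    apply is_derive_Cexp, is_derive_Cmult; [|apply is_derive_Cconst].
    apply is_derive_RtoC, (is_derive_id (K := R_AbsRing)).
  - change (@one R_AbsRing) with 1; cbn beta; C_change; ring. }
rewrite <- HZ.
assert (La : is_lim_seq (sum_n a) (PSeries a 1)).
{ apply (filterlim_ext (sum_n (fun j => a j * 1 ^ j)));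
    [|exact (proj1 (is_pseries_R _ _ _) (Ha 1))].
  intros N; apply sum_n_ext; intros j; rewrite pow1; apply Rmult_1_r. }
assert (Lb : is_lim_seq (sum_n b) (PSeries b 1)).
{ apply (filterlim_ext (sum_n (fun j => b j * 1 ^ j)));
    [|exact (proj1 (is_pseries_R _ _ _) (Hb 1))].
  intros N; apply sum_n_ext; intros j; rewrite pow1; apply Rmult_1_r. }
apply is_lim_seq_0_le with (fun N => Rabs (sum_n a N - PSeries a 1) +
  Rabs (sum_n b N - PSeries b 1)).
- intros N; split; [apply Cmod_ge_0|].
  set (s := Csum _ N).
  replace (s - Z 1)%C with (RtoC (sum_n a N - PSeries a 1) + Ci * RtoC (sum_n b N - PSeries b 1))%C.
  + apply Rle_trans with (1 := Cmod_triangle _ _).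
    rewrite Cmod_mult, !Cmod_R.
    replace (Cmod Ci) with 1; [lra|].
    unfold Cmod, Ci; cbn; rewrite Rmult_0_l, Rplus_0_l, !Rmult_1_r, sqrt_1; reflexivity.
  + replace (sum_n a N) with (fst s) by apply fst_Csum.
    replace (sum_n b N) with (snd s) by apply snd_Csum.
    unfold Z; generalize s (PSeries a 1) (PSeries b 1); intros s' u v.
    apply injective_projections; cbn; ring.
- replace 0 with (0 + 0) by ring.
  assert (lim0 : forall u l, is_lim_seq u (Finite l) -> is_lim_seq (fun N => Rabs (u N - l)) 0).
  { intros u l Hu; rewrite <- Rabs_R0.
    apply (is_lim_seq_abs _ 0); replace 0 with (l - l) by ring.
    apply is_lim_seq_minus'; [exact Hu|apply is_lim_seq_const]. }
  apply is_lim_seq_plus'; apply lim0; assumption.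
Qed.

Lemma binom_ge_0 n k : 0 <= binom n k.
Proof. apply pos_INR. Qed.

(** * The negative binomial series *)

Definition nbin (rho : C) (j N : nat) : C := Csum (fun m => binom m j * rho ^ m)%C N.

(** Pascal's rule summed over m; the subtracted term is the one by which the shifted sum
    overshoots N. *)
Lemma nbin_S (rho : C) (j N : nat) :
  ((1 - rho) * nbin rho (S j) N = rho * nbin rho j N - binom (S N) (S j) * rho ^ S N)%C.
Proof.
unfold nbin.
assert (E : (Csum (fun m => binom m (S j) * rho ^ m) (S N) =
   rho * Csum (fun m => binom m (S j) * rho ^ m) N + rho * Csum
     (fun m => binom m j * rho ^ m) N)%C).
{ rewrite Csum_shift, binom_0_S, <- !Csum_mult_l, <- Csum_plus, Cmult_0_l, Cplus_0_l.
  apply sum_n_ext; intros m; rewrite binom_S_S, RtoC_plus, Cpow_S; C_change; ring. }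
rewrite Csum_S in E.
set (u := Csum _ N) in *; set (v := Csum _ N) in *.
transitivity (u + binom (S N) (S j) * rho ^ S N - rho * u - binom (S N) (S j) * rho ^ S N)%C;
  [C_change; ring|].
rewrite E; C_change; ring.
Qed.

Lemma nbin_0 (rho : C) (N : nat) : ((1 - rho) * nbin rho 0 N = 1 - rho ^ S N)%C.
Proof.
unfold nbin; induction N as [|N IH].
- rewrite sum_O, binom_0_r; cbn; C_change; ring.
- rewrite Csum_S, Cmult_plus_distr_l, IH, binom_0_r, !Cpow_S; C_change; ring.
Qed.

(** For r >= 0 the subtracted terms of [nbin_S] and [nbin_0] are nonnegative; dropping
    them turns these identities into bounds uniform in N. *)
Lemma nbin_real_bound (r : R) (j N : nat) : 0 <= r < 1 ->
  sum_n (fun m => binom m j * r ^ m) N <= r ^ j / (1 - r) ^ S j.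
Proof.
intros hr.
assert (E : forall j, nbin r j N = RtoC (sum_n (fun m => binom m j * r ^ m) N)).
{ intros i; unfold nbin; induction N as [|n IH]; [rewrite !sum_O|rewrite Csum_S, sum_Sn, IH,
    RtoC_plus];
  rewrite RtoC_mult, RtoC_pow; reflexivity. }
assert (hN := pow_le r (S N) (proj1 hr)).
induction j as [|j IH].
- assert (H := nbin_0 r N); rewrite E, <- RtoC_pow, <- !RtoC_minus, <- RtoC_mult in H.
  apply RtoC_inj in H; apply Rle_div_r; [cbn; lra|].
  rewrite Rmult_comm; cbn [pow] in *; rewrite Rmult_1_r, H; lra.
- assert (H := nbin_S r j N); rewrite !E, <- RtoC_pow, <- !RtoC_mult, <- !RtoC_minus,
    <- RtoC_mult in H.
  apply RtoC_inj in H.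
  replace (r ^ S j / (1 - r) ^ S (S j)) with (r * (r ^ j / (1 - r) ^ S j) / (1 - r)).
  + apply Rle_div_r; [lra|]; rewrite Rmult_comm, H.
    generalize (Rmult_le_pos _ _ (binom_ge_0 (S N) (S j)) hN).
    generalize (Rmult_le_compat_l r _ _ (proj1 hr) IH); lra.
  + cbn [pow]; field; repeat split; try apply pow_nonzero; lra.
Qed.

Lemma nbin_bound (rho : C) (j N : nat) : Cmod rho < 1 ->
  Cmod (nbin rho j N) <= Cmod rho ^ j / (1 - Cmod rho) ^ S j.
Proof.
intros h; apply Rle_trans with (1 := Cmod_Csum_le _ _).
apply Rle_trans with (2 := nbin_real_bound (Cmod rho) j N (conj (Cmod_ge_0 _) h)).
apply Req_le, sum_n_ext; intros m.
rewrite Cmod_mult, Cmod_pow, Cmod_R, Rabs_pos_eq by apply pos_INR; reflexivity.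
Qed.

(** The partial sums increase and are bounded, so the series converges. *)
Lemma nbin_term_lim (r : R) (j : nat) : 0 <= r < 1 -> is_lim_seq (fun N => binom N j * r ^ N) 0.
Proof.
intros hr; apply ex_series_lim_0.
assert (H : ex_finite_lim_seq (sum_n (fun m => binom m j * r ^ m))).
{ apply ex_finite_lim_seq_incr with (r ^ j / (1 - r) ^ S j).
  - intros n; rewrite sum_Sn; unfold plus; cbn -[sum_n pow].
    generalize (Rmult_le_pos _ _ (binom_ge_0 (S n) j) (pow_le r (S n) (proj1 hr))); lra.
  - intros n; apply nbin_real_bound, hr. }
destruct H as [l Hl]; exists l; exact Hl.
Qed.

Lemma Cminus_1_neq_0 (rho : C) : Cmod rho < 1 -> (1 - rho)%C <> 0.
Proof.
intros h e.
assert (e' : rho = 1) by (transitivity (1 - (1 - rho))%C; [ring|rewrite e; ring]).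
rewrite e', Cmod_1 in h; lra.
Qed.

(** In [nbin_S] the subtracted term tends to 0, so that the limits l_j satisfy
    (1 - rho) l_{j+1} = rho l_j. *)
Lemma nbin_lim (rho : C) (j : nat) : Cmod rho < 1 ->
  Clim (nbin rho j) (rho ^ j / (1 - rho) ^ S j)%C.
Proof.
intros h; assert (h1 := Cminus_1_neq_0 rho h).
assert (hm : 0 < Cmod (1 - rho)) by apply Cmod_gt_0, h1.
assert (hr : 0 <= Cmod rho < 1) by (split; [apply Cmod_ge_0|exact h]).
assert (term : forall i, is_lim_seq (fun N => binom (S N) i * Cmod rho ^ S N) 0).
{ intros i; apply (is_lim_seq_incr_1 (fun N => binom N i * Cmod rho ^ N)), nbin_term_lim, hr. }
induction j as [|j IH].
- apply is_lim_seq_ext with (fun N => / Cmod (1 - rho) * (binom (S N) 0 * Cmod rho ^ S N)).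
  + intros N.
    replace (nbin rho 0 N - rho ^ 0 / (1 - rho) ^ 1)%C with (- rho ^ S N / (1 - rho))%C.
    * rewrite Cmod_div, Cmod_opp, Cmod_pow, binom_0_r by exact h1; unfold Rdiv; ring.
    * replace (nbin rho 0 N) with ((1 - rho) * nbin rho 0 N / (1 - rho))%C by (field; exact h1).
      rewrite nbin_0; cbn [Cpow]; field; exact h1.
  + replace (Finite 0) with (Rbar_mult (/ Cmod (1 - rho)) 0) by (cbn; f_equal; ring).
    apply is_lim_seq_scal_l, term.
- apply is_lim_seq_0_le with (fun N => / Cmod (1 - rho) *
    (Cmod rho * Cmod (nbin rho j N - rho ^ j / (1 - rho) ^ S j) +
      binom (S N) (S j) * Cmod rho ^ S N)).
  + intros N; split; [apply Cmod_ge_0|].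
    replace (nbin rho (S j) N - rho ^ S j / (1 - rho) ^ S (S j))%C with
     ((rho * (nbin rho j N - rho ^ j / (1 - rho) ^ S j) +
       - (binom (S N) (S j) * rho ^ S N)) / (1 - rho))%C.
    * rewrite Cmod_div by exact h1; unfold Rdiv; rewrite Rmult_comm.
      apply Rmult_le_compat_l; [apply Rlt_le, Rinv_0_lt_compat, hm|].
      apply Rle_trans with (1 := Cmod_triangle _ _), Req_le.
      rewrite Cmod_opp, !Cmod_mult, Cmod_pow, Cmod_R, Rabs_pos_eq by apply pos_INR; reflexivity.
    * replace (nbin rho (S j) N) with ((1 - rho) * nbin rho (S j) N / (1 - rho))%C by (field;
        exact h1).
      rewrite nbin_S, !(Cpow_S _ j), !(Cpow_S _ (S j)), !(Cpow_S _ j).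
      field; split; [apply Cpow_nz|]; exact h1.
  + replace (Finite 0) with (Rbar_mult (/ Cmod (1 - rho)) (Cmod rho * 0 + 0)) by (cbn; f_equal;
      ring).
    apply is_lim_seq_scal_l, is_lim_seq_plus'; [|apply term].
    apply (is_lim_seq_scal_l _ (Cmod rho) 0), IH.
Qed.

(** * The generating function of the Laguerre polynomials *)

Lemma Csum_binom_extend (u : nat -> C) (m N : nat) : (m <= N)%nat ->
  Csum (fun j => binom m j * u j)%C N = Csum (fun j => binom m j * u j)%C m.
Proof.
induction 1 as [|N hN IH]; [reflexivity|].
rewrite Csum_S, IH, binom_gt, Cmult_0_l, Cplus_0_r by lia; reflexivity.
Qed.

Lemma Csum_binom_switch (u : nat -> C) (rho : C) (N : nat) :
  Csum (fun m => rho ^ m * Csum (fun j => binom m j * u j) m)%C N =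
  Csum (fun j => u j * nbin rho j N)%C N.
Proof.
rewrite (sum_n_ext_loc (G := C_AbelianMonoid) _
  (fun m => Csum (fun j => u j * (binom m j * rho ^ m))%C N)).
- rewrite (sum_n_switch (G := C_AbelianMonoid) (fun m j => u j * (binom m j * rho ^ m))%C).
  apply sum_n_ext; intros j; apply Csum_mult_l.
- intros m hm; rewrite <- (Csum_binom_extend u m N hm), <- Csum_mult_l.
  apply sum_n_ext; intros j; C_change; ring.
Qed.

Lemma Cmod_1_minus_ge (rho : C) : 1 - Cmod rho <= Cmod (1 - rho).
Proof.
generalize (Cmod_triangle (1 - rho) rho).
replace (1 - rho + rho)%C with (RtoC 1) by ring; rewrite Cmod_1; lra.
Qed.

(** After exchanging the sums, the partial sum is sum_{j<=N} e_j nbin_j(N), with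
    e_j = y^j/j!.  Replacing nbin_j(N) by its limit l_j costs a quantity handled by
    [tannery], with the dominating sequence 2 |e_j| r^j/(1-r)^(j+1); what is left is an
    exponential series, because e_j l_j = (1/(1-rho)) (rho y/(1-rho))^j / j!. *)
Lemma laguerre_generating (rho y : C) : Cmod rho < 1 ->
  Clim (Csum (fun m => rho ^ m * Csum (fun j => binom m j * (y ^ j / INR (fact j))) m)%C)
    (1 / (1 - rho) * Cexp (rho / (1 - rho) * y))%C.
Proof.
intros h; assert (h1 := Cminus_1_neq_0 rho h).
assert (hr := Cmod_ge_0 rho); set (r := Cmod rho) in *.
assert (hm := Cmod_1_minus_ge rho); fold r in hm.
set (e := fun j => (y ^ j / INR (fact j))%C).
set (l := fun j => (rho ^ j / (1 - rho) ^ S j)%C).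
set (s := (rho / (1 - rho) * y)%C).
assert (hl : forall j, Cmod (l j) <= r ^ j / (1 - r) ^ S j).
{ intros j; unfold l; rewrite Cmod_div, !Cmod_pow by (apply Cpow_nz, h1); fold r.
  apply Rmult_le_compat_l; [apply pow_le, hr|].
  apply Rinv_le_contravar; [apply pow_lt; lra|apply pow_incr; lra]. }
assert (hv : forall N, Csum (fun j => e j * l j)%C N =
  (1 / (1 - rho) * Csum (fun j => s ^ j / INR (fact j)) N)%C).
{ intros N; rewrite <- Csum_mult_l; apply sum_n_ext; intros j; unfold e, l, s.
  assert (hf : RtoC (INR (fact j)) <> 0) by apply RtoC_INR_fact_neq_0.
  unfold Cdiv; rewrite !Cpow_mult_l, Cpow_inv, Cpow_S by exact h1.
  C_change.
  field; repeat split; try apply Cpow_nz; assumption. }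
change (is_lim_seq (fun N => Cmod (Csum (fun m => rho ^ m * Csum (fun j => binom m j * e j) m) N
  - 1 / (1 - rho) * Cexp s)%C) 0).
apply is_lim_seq_0_le with (fun N =>
  sum_n (fun j => Cmod (e j) * Cmod (nbin rho j N - l j)) N +
  Cmod (1 / (1 - rho)) * Cmod (Csum (fun j => s ^ j / INR (fact j))%C N - Cexp s)).
- intros N; split; [apply Cmod_ge_0|].
  rewrite (Csum_binom_switch e), <- Cmod_mult.
  replace (Csum (fun j => e j * nbin rho j N) N - 1 / (1 - rho) * Cexp s)%C with
   (Csum (fun j => e j * (nbin rho j N - l j)) N + 1 / (1 - rho) * (Csum (fun j => s ^ j / INR
     (fact j)) N - Cexp s))%C.
  + apply Rle_trans with (1 := Cmod_triangle _ _), Rplus_le_compat_r.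
    apply Rle_trans with (1 := Cmod_Csum_le _ _), Req_le.
    apply sum_n_ext; intros j; apply Cmod_mult.
  + rewrite (sum_n_ext (G := C_AbelianMonoid) (fun j => e j * nbin rho j N)%C
      (fun j => e j * (nbin rho j N - l j) + e j * l j)%C) by (intros j; C_change; ring).
    rewrite Csum_plus, hv; C_change; ring.
- replace (Finite 0) with (Finite (0 + 0)) by (f_equal; ring).
  apply is_lim_seq_plus'; [|apply is_lim_seq_scal_0, Cexp_series].
  apply (tannery (fun j N => Cmod (e j) * Cmod (nbin rho j N - l j))
    (fun j => Cmod (e j) * (2 * (r ^ j / (1 - r) ^ S j)))).
  + intros j N; split; [apply Rmult_le_pos; apply Cmod_ge_0|].
    apply Rmult_le_compat_l; [apply Cmod_ge_0|].
    apply Rle_trans with (1 := Cmod_triangle _ _); rewrite Cmod_opp.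
    generalize (hl j) (nbin_bound rho j N h); fold r; lra.
  + exists (2 / (1 - r) * exp (Cmod y * r / (1 - r))).
    apply is_series_ext with (fun j => scal (2 / (1 - r)) (scal (pow_n (Cmod y * r / (1 - r)) j)
      (/ INR (fact j)))).
    * intros j; unfold e; rewrite Cmod_pow_over_fact, pow_n_pow; unfold scal;
        cbn -[pow fact INR]; unfold mult; cbn -[pow fact INR].
      unfold Rdiv; rewrite !Rpow_mult_distr, pow_inv; cbn [pow].
      R_change.
      field; repeat split; try apply pow_nonzero; try apply INR_fact_neq_0; lra.
    * apply (is_series_scal (V := R_NormedModule) (2 / (1 - r)) _ (exp (Cmod y * r / (1 - r)))),
        is_exp_Reals.
  + intros j; apply is_lim_seq_scal_0, nbin_lim, h.
Qed.

(** * The integrals I_{a,m} and their sum *)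

Lemma sqrt2_sqr : (RtoC (sqrt 2) * RtoC (sqrt 2) = 2)%C.
Proof. rewrite <- RtoC_mult, sqrt_sqrt by lra; reflexivity. Qed.

Lemma sqrt2_neq_0 : RtoC (sqrt 2) <> 0.
Proof.
intros e; apply RtoC_inj in e; generalize (sqrt_lt_R0 2 ltac:(lra)); lra.
Qed.

(** Turns identities with sqrt 2 in denominators into polynomial identities modulo
    [sqrt2_sqr]. *)
Lemma Cdiv_sqrt2 (u : C) : (u / RtoC (sqrt 2) = u * RtoC (sqrt 2) / 2)%C.
Proof.
rewrite <- sqrt2_sqr; field; exact sqrt2_neq_0.
Qed.

Lemma RtoC_div_sqrt2 (u : R) : RtoC (u / sqrt 2) = (u / RtoC (sqrt 2))%C.
Proof. apply RtoC_div; generalize (sqrt_lt_R0 2 ltac:(lra)); lra. Qed.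

Lemma RtoC_Re_conj (u : C) : RtoC (Re (u + Cconj u)) = (u + Cconj u)%C.
Proof. apply injective_projections; cbn; ring. Qed.

Lemma Rpower_PI_sqr : (RtoC (Rpower PI (- / 4)) * RtoC (Rpower PI (- / 4)) * RtoC (sqrt PI) = 1)%C.
Proof.
assert (hpi := PI_RGT_0).
rewrite <- !RtoC_mult, <- (Rpower_sqrt PI), <- !Rpower_plus by exact hpi.
replace (- / 4 + - / 4 + / 2) with 0 by field; rewrite Rpower_O by exact hpi; reflexivity.
Qed.

(** [is_int_herm_gauss] with p = sqrt 2 Re z, q = sqrt 2 Re w + a.  Then
    2p - kappa = sqrt 2 conj zeta and 2q - kappa = - sqrt 2 zeta for
    zeta = z - a/sqrt 2 - w, so half their product is -|zeta|^2.  The constant exponent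
    gam and kappa^2/4 add up to the exponent of the closed form, and the factor
    pi^(-1/4) of each kernel cancels sqrt pi. *)
Lemma I_int_value (a : R) (m : nat) (z w : C) :
  I_int a m z w =
  (RtoC (2 ^ m * INR (fact m)) *
   (Cexp (RtoC (- (a ^ 2 / 4)) + z * RtoC a / RtoC (sqrt 2)) *
    Cexp ((z - RtoC a / RtoC (sqrt 2)) * Cconj w)) *
   Csum (fun j => binom m j *
     ((- RtoC (Cmod (z - RtoC a / RtoC (sqrt 2) - w) ^ 2)) ^ j / INR (fact j))) m)%C.
Proof.
set (s := RtoC (sqrt 2)).
set (p := Re (z + Cconj z) / sqrt 2); set (q := Re (w + Cconj w) / sqrt 2 + a).
set (kappa := (s * (z + Cconj w) + RtoC a)%C).
(* The exponents of the two kernels add up to -x^2 + kappa x + gam. *)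
set (gam := (- (z * z + RtoC a * RtoC a + Cconj w * Cconj w) / 2 - s * Cconj w * RtoC a)%C).
set (c := RtoC (Rpower PI (- / 4))).
assert (hs : (s * s = 2)%C) by exact sqrt2_sqr.
assert (H := is_int_Cmult (c * c * Cexp gam) _ _ (is_int_herm_gauss kappa p q m 0)).
rewrite Nat.add_0_r in H.
assert (Hx : forall x, (c * c * Cexp gam * herm_gauss kappa p q m m x)%C = I_integrand a m z w x).
{ intros x; unfold I_integrand, herm_gauss, SB_kernel; fold s c p.
  replace (Re (w + Cconj w) / sqrt 2 - x + a) with (q - x) by (unfold q; ring).
  rewrite Cmult_conj, Cexp_conj.
  replace (Cconj c) with c by (apply injective_projections; cbn; ring).
  replace (Cconj (- / 2 * (RtoC (x - a) ^ 2 + w ^ 2) + s * w * RtoC (x - a)))%C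
    with (- / 2 * (RtoC (x - a) ^ 2 + Cconj w ^ 2) + s * Cconj w * RtoC (x - a))%C
    by (apply injective_projections; cbn; field).
  transitivity (c * c * (Cexp gam * Cexp (- (RtoC x * RtoC x) + kappa * RtoC x)) *
    RtoC (hermite m (p - x) * hermite m (q - x)))%C; [ring|].
  rewrite <- Cexp_plus.
  replace (gam + (- (RtoC x * RtoC x) + kappa * RtoC x))%C with
    (- / 2 * (RtoC x ^ 2 + z ^ 2) + s * z * RtoC x +
     (- / 2 * (RtoC (x - a) ^ 2 + Cconj w ^ 2) + s * Cconj w * RtoC (x - a)))%C
    by (rewrite RtoC_minus; unfold gam, kappa; field).
  rewrite Cexp_plus, RtoC_mult; ring. }
unfold I_int; rewrite (is_RInt_gen_unique (V := C_R_CompleteNormedModule) (I_integrand a m z w) _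
 (is_int_ext _ _ _ Hx H)).
replace (c * c * Cexp gam * (RtoC (sqrt PI) * Cexp (kappa * kappa / 4) * RtoC (2 ^ m * INR
  (fact m)) *
    laguerre_sum (2 * RtoC p - kappa) (2 * RtoC q - kappa) m 0))%C with
   ((c * c * RtoC (sqrt PI)) * RtoC (2 ^ m * INR (fact m)) * (Cexp gam * Cexp (kappa * kappa / 4)) *
     laguerre_sum (2 * RtoC p - kappa) (2 * RtoC q - kappa) m 0)%C by ring.
unfold c; rewrite Rpower_PI_sqr, Cmult_1_l; f_equal; [f_equal|].
- rewrite <- !Cexp_plus; f_equal.
  unfold s; rewrite !Cdiv_sqrt2; fold s; unfold gam, kappa.
  replace (RtoC (- (a ^ 2 / 4))) with (- (RtoC a * RtoC a / 4))%C
    by (apply injective_projections; cbn; field).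
  replace ((s * (z + Cconj w) + RtoC a) * (s * (z + Cconj w) + RtoC a) / 4)%C with
   ((s * s) * ((z + Cconj w) * (z + Cconj w)) / 4 + s * RtoC a * (z + Cconj w) / 2 +
     RtoC a * RtoC a / 4)%C by field.
  rewrite hs; field.
- unfold laguerre_sum; apply sum_n_ext; intros j; cbn [Nat.add].
  assert (E : ((2 * RtoC p - kappa) * ((2 * RtoC q - kappa) / 2) =
    - RtoC (Cmod (z - RtoC a / s - w) ^ 2))%C).
  { rewrite Cmod2_conj.
    set (t := RtoC (a / sqrt 2)).
    replace (RtoC a / s)%C with t by apply RtoC_div_sqrt2.
    assert (hat : RtoC a = (s * t)%C).
    { unfold t; rewrite RtoC_div_sqrt2; unfold s; field; exact sqrt2_neq_0. }
    rewrite !Cminus_conj.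
    replace (Cconj t) with t by (apply injective_projections; cbn; ring).
    assert (hp : RtoC p = ((z + Cconj z) * s / 2)%C).
    { unfold p; rewrite RtoC_div_sqrt2, Cdiv_sqrt2, RtoC_Re_conj; reflexivity. }
    assert (hq : RtoC q = ((w + Cconj w) * s / 2 + RtoC a)%C).
    { unfold q; rewrite RtoC_plus, RtoC_div_sqrt2, Cdiv_sqrt2, RtoC_Re_conj; reflexivity. }
    rewrite hp, hq; unfold kappa; rewrite hat.
    transitivity (s * s / 2 * ((Cconj z - Cconj w - t) * (w - z + t)))%C; [field|].
    rewrite hs; field. }
  rewrite <- E, Cpow_mult_l; unfold Cdiv; C_change; ring.
Qed.

Theorem theorem6p24 (a : R) (z w rho : C) (hrho : (Cmod rho < 1)%R) :
  filterlim (fun N : nat => S_sum rho a N z w) eventually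
    (locally (closed_form rho a z w)) /\
  is_series (fun m : nat => (rho ^ m / RtoC (2 ^ m * INR (fact m))%R * I_int a m z w)%C)
    (closed_form rho a z w).
Proof.
cut (Clim (fun N => S_sum rho a N z w) (closed_form rho a z w)).
{ intros H; apply Clim_filterlim in H; split; exact H. }
set (g := (Cexp (RtoC (- (a ^ 2 / 4)) + z * RtoC a / RtoC (sqrt 2)) *
    Cexp ((z - RtoC a / RtoC (sqrt 2)) * Cconj w))%C).
set (y := (- RtoC (Cmod (z - RtoC a / RtoC (sqrt 2) - w) ^ 2))%C).
assert (H := laguerre_generating rho y hrho).
apply (is_lim_seq_scal_0 (Cmod g)) in H.
apply is_lim_seq_ext with (2 := H); intros N; rewrite <- Cmod_mult; f_equal.
transitivity (Csum (fun m => g * (rho ^ m * Csum (fun j => binom m j * (y ^ j / INR (fact j))) m)) N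
  - closed_form rho a z w)%C.
- rewrite Csum_mult_l; unfold closed_form.
  replace (- (rho / (1 - rho)) * RtoC (Cmod (z - RtoC a / RtoC (sqrt 2) - w) ^ 2))%C
    with (rho / (1 - rho) * y)%C
    by (unfold y; ring).
  unfold g; ring.
- f_equal; unfold S_sum; apply sum_n_ext; intros m; rewrite I_int_value; fold g y.
  C_change; field.
  intros e; apply RtoC_inj in e; revert e; apply Rmult_integral_contrapositive; split;
    [apply pow_nonzero; lra|apply INR_fact_neq_0].
Qed.
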